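(* Let $\varphi$ be an endomorphism of a subshift $(X,\sigma)$. Let $s\in\mathbb Z$. (1)(a) $\varphi^{[t]}$ is weakly LR for some $t\ge1$ if and only if $P_L(\varphi)\ge0$ and $Q_R(\varphi)\ge0$. (b) If $(\varphi\sigma^s)^{[t]}$ is weakly LR for some $t\ge1$, then $s\ge C_R(\varphi)$. There exists $t\ge1$ such that for all integers $s$ with $C_R(\varphi)\le s\le C_R(\varphi)+t-1$, $(\varphi\sigma^s)^{[t-s+C_R(\varphi)]}$ is weakly LR, and $\varphi\sigma^s$ is weakly LR for all $s\ge C_R(\varphi)+t$. (c) If $s>C_R(\varphi)$ and $\varphi$ is onto, then $\varphi\sigma^s$ is expansive. (2)(a) $\varphi^{[t]}$ is weakly RL for some $t\ge1$ if and only if $P_R(\varphi)\ge0$ and $Q_L(\varphi)\ge0$. (b) If $(\varphi\sigma^s)^{[t]}$ is weakly RL for some $t\ge1$, then $s\le C_L(\varphi)$. There exists $t\ge1$ such that for all integers $s$ with $C_L(\varphi)-t+1\le s\le C_L(\varphi)$, $(\varphi\sigma^s)^{[t+s-C_L(\varphi)]}$ is weakly RL, and $\varphi\sigma^s$ is weakly RL for all $s\le C_L(\varphi)-t$. (c) If $s<C_L(\varphi)$ and $\varphi$ is onto, then $\varphi\sigma^s$ is expansive.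
   Context: **Subshifts.** An alphabet is a finite set with at least two elements. For an alphabet $A$, $A^{\mathbb Z}$ carries the product topology; the shift maps $(a_j)_j$ to $(a_{j+1})_j$. A subshift $(X,\sigma)$ over $A$ is a closed $X\subset A^{\mathbb Z}$ with $\sigma(X)=X$, $\sigma$ being the restricted shift; $d_X$ is a compatible metric; $L_k(X)$ is the set of words of length $k$ occurring in points of $X$. An endomorphism of $(X,\sigma)$ is a continuous map $\varphi:X\to X$ commuting with $\sigma$ (not assumed onto). An onto $\varphi$ is expansive if there is $\delta>0$ such that for any sequences $(x_i)_{i\in\mathbb Z},(y_i)_{i\in\mathbb Z}$ in $X$ with $\varphi(x_i)=x_{i+1}$, $\varphi(y_i)=y_{i+1}$, $d_X(x_i,y_i)\le\delta$ for all $i\in\mathbb Z$ implies $(x_i)=(y_i)$. **Higher blocks.** For $t\ge1$, $X^{[t]}=\{(a_j\dots a_{j+t-1})_{j\in\mathbb Z}: (a_j)\in X\}$, a subshift over the alphabet $L_t(X)$ with shift $\sigma^{[t]}$; if $\varphi((a_j))=(b_j)$ then $\varphi^{[t]}$ maps $(a_j\dots a_{j+t-1})_j$ to $(b_j\dots b_{j+t-1})_j$, an endomorphism of $(X^{[t]},\sigma^{[t]})$. **Type.** A local rule of neighborhood-size $N\ge 0$ on $X$ is a map $f:L_{N+1}(X)\to L_1(X)$ with $(f(a_j\dots a_{j+N}))_{j\in\mathbb Z}\in X$ for all $(a_j)\in X$. For $m,n\ge0$, $m+n=N$, $\varphi$ is of $(m,n)$-type given by $f$ if $\varphi((a_j)_j)=(f(a_{j-m}\dots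 a_{j+n}))_j$. Every endomorphism arises this way. **Degrees.** Let $f$ be a local rule of neighborhood-size $N$. It is $I$ left-redundant ($I\ge0$) if for all $(a_j),(b_j)\in X$, $a_j=b_j$ for all $j\ge0$ implies $f(a_{-I}\dots a_{-I+N})=f(b_{-I}\dots b_{-I+N})$; $I$ right-redundant if $a_j=b_j$ for all $j\le0$ implies $f(a_{I-N}\dots a_I)=f(b_{I-N}\dots b_I)$. It is strictly $I$ left-redundant if $I$ left-redundant but not $I+1$ left-redundant, strictly $\infty$ left-redundant if $I$ left-redundant for all $I\ge0$; similarly for right. It is $k$ right-mergible ($k\ge0$) if $a_j=b_j$ for $j\le 0$ and $f(a_{j-N}\dots a_j)=f(b_{j-N}\dots b_j)$ for $1\le j\le k+1$ imply $a_1=b_1$; $k$ left-mergible if $a_j=b_j$ for $j\ge0$ and $f(a_{-j}\dots a_{-j+N})=f(b_{-j}\dots b_{-j+N})$ for $1\le j\le k+1$ imply $a_{-1}=b_{-1}$. It is strictly $k$ right-mergible if $k\ge 0$ is the least integer for which it is $k$ right-mergible, strictly $\infty$ right-mergible if there is none; similarly for left. If $\varphi$ is of $(m,n)$-type given by $f$ which is strictly $I$ left-redundant, strictly $J$ right-redundant, strictly $k$ right-mergible and strictly $l$ left-mergible, then $P_L(\varphi)=I-m$, $P_R(\varphi)=J-n$, and, if $X$ is infinite, $Q_R(\varphi)=n-k$, $Q_L(\varphi)=m-l$; if $X$ is finite, $Q_R(\varphi)=Q_L(\varphi)=\infty$. These are independent of the choice of $f,m,n$. Put $C_R(\varphi)=\max\{-P_L(\varphi),-Q_R(\varphi)\}$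 and $C_L(\varphi)=\min\{P_R(\varphi),Q_L(\varphi)\}$. Usual conventions for arithmetic and order with $\pm\infty$ are used. **Graphs and textile systems.** A graph is a finite directed graph $G$ (multiple arcs, loops allowed) with arc-set $A_G$, vertex-set $V_G$ and initial/terminal vertex maps $i_G,t_G$; $X_G\subset A_G^{\mathbb Z}$ is the set of bi-infinite paths. A graph-homomorphism $h=(h_A,h_V):\Gamma\to G$ is a pair of maps on arcs and vertices compatible with $i,t$; it induces $\phi_h:X_\Gamma\to X_G$, $(\alpha_j)\mapsto(h_A(\alpha_j))$. $h$ is weakly left-resolving (resp. weakly right-resolving) if every arc $\alpha$ of $\Gamma$ is uniquely determined by $t_\Gamma(\alpha)$ (resp. $i_\Gamma(\alpha)$) and $h_A(\alpha)$. A textile system $T=(p,q:\Gamma\to G)$ is a pair of graph-homomorphisms; it is weakly LR if $p$ is weakly left-resolving and $q$ is weakly right-resolving, weakly RL if $p$ is weakly right-resolving and $q$ is weakly left-resolving. An endomorphism $\varphi$ of a subshift $(X,\sigma)$ is weakly LR (resp. RL) if there are a weakly LR (resp. RL) textile system $T=(p,q:\Gamma\to G)$ and a closed shift-invariant $Z\subset X_\Gamma$ such that $\phi_p|_Z$ is injective, $\phi_p(Z)=X$, $\phi_q(Z)\subset X$ and $\varphi=\phi_q\circ(\phi_p|_Z)^{-1}$. *)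

(* Defs.v *)
From mathcomp Require Import all_boot all_order all_algebra.
From mathcomp Require Import all_classical all_reals all_analysis.

Set Implicit Arguments.
Unset Strict Implicit.
Unset Printing Implicit Defensive.

Import Order.TTheory GRing.Theory Num.Theory.
Local Open Scope classical_set_scope.
Local Open Scope ring_scope.

(** * Subshifts and endomorphisms *)

(* A^Z with the product of the discrete topologies. *)
Definition config (A : choiceType) : Type :=
  prod_topology (fun _ : int => discrete_topology A).

(* sigma^s for any integer s; the shift itself is [sigma_pow 1]. *)
Definition sigma_pow (A : choiceType) (s : int) (a : config A) : config A :=
  fun j => a (j + s).

Definition subshift (A : choiceType) (X : set (config A)) : Prop :=
  closed X /\ sigma_pow 1 @` X = X.

(* Maps X -> X are represented by functions on the full space of which only
   the restriction to X matters. *)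
Definition endomorphism (A : choiceType) (X : set (config A))
    (phi : config A -> config A) : Prop :=
  [/\ {within X, continuous phi},
      phi @` X `<=` X
    & forall a, X a -> phi (sigma_pow 1 a) = sigma_pow 1 (phi a)].

(* [d] restricts to a metric on X inducing the subspace topology; its values
   at points outside X are irrelevant. *)
Definition compatible_metric (R : realType) (A : choiceType)
    (X : set (config A)) (d : config A -> config A -> R) : Prop :=
  [/\ forall x y, X x -> X y -> 0 <= d x y,
      forall x y, X x -> X y -> (d x y = 0 <-> x = y),
      forall x y, X x -> X y -> d x y = d y x,
      forall x y z, X x -> X y -> X z -> d x z <= d x y + d y z
    & forall x (U : set (config A)), X x ->
        (within X (nbhs x) U <->
         exists2 e : R, 0 < e & forall y, X y -> d x y < e -> U y)].

(* A full two-sided orbit of [phi] in X; [phi] need not be invertible. *)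
Definition full_orbit (A : choiceType) (X : set (config A))
    (phi : config A -> config A) (x : int -> config A) : Prop :=
  forall i, X (x i) /\ phi (x i) = x (i + 1).

Definition expansive (R : realType) (A : choiceType) (X : set (config A))
    (d : config A -> config A -> R) (phi : config A -> config A) : Prop :=
  exists2 delta : R, 0 < delta &
    forall x y : int -> config A,
      full_orbit X phi x -> full_orbit X phi y ->
      (forall i, d (x i) (y i) <= delta) -> x = y.

(** * Words and higher blocks *)

(* The word a_j ... a_(j+k-1). *)
Definition word (A : choiceType) (a : config A) (j : int) (k : nat) :
    k.-tuple A := [tuple a (j + i%:Z) | i < k].

Definition letters (A : choiceType) (X : set (config A)) : set A :=
  [set c | exists2 a, X a & exists j, a j = c].

Definition block (A : choiceType) (t : nat) (a : config A) :
    config (t.-tuple A) := fun j => word a j t.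

(* X^[t], over the ambient alphabet of all t-tuples; the letters that occur
   in it are exactly the words of length t of X. *)
Definition higher_block (A : choiceType) (t : nat) (X : set (config A)) :
    set (config (t.-tuple A)) := @block A t @` X.

(* phi^[t]: a point of X^[t] is decoded by reading first letters of its
   blocks.  Only t >= 1 is meaningful. *)
Definition higher_map (A : choiceType) (t : nat)
    (phi : config A -> config A) :
    config (t.-tuple A) -> config (t.-tuple A) :=
  match t return config (t.-tuple A) -> config (t.-tuple A) with
  | 0%N => id
  | t'.+1 => fun y => block t'.+1 (phi (fun j => thead (y j)))
  end.

Arguments higher_block {A} t X.
Arguments higher_map {A} t phi.

(** * Local rules and degrees *)

(* Only the values of [f] on words of X of length N+1 matter. *)
Definition local_rule (A : choiceType) (X : set (config A)) (N : nat)
    (f : N.+1.-tuple A -> A) : Prop :=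
  forall a, X a -> X (fun j => f (word a j N.+1)).

Definition has_type (A : choiceType) (X : set (config A))
    (phi : config A -> config A) (m n : nat)
    (f : (m + n).+1.-tuple A -> A) : Prop :=
  local_rule X f /\
  forall a, X a -> phi a = (fun j => f (word a (j - m%:Z) (m + n).+1)).

Section Degrees.
Variables (A : choiceType) (X : set (config A)) (N : nat).
Variable f : N.+1.-tuple A -> A.

Definition left_redundant (I : nat) : Prop :=
  forall a b, X a -> X b -> (forall j, 0 <= j -> a j = b j) ->
  f (word a (- I%:Z) N.+1) = f (word b (- I%:Z) N.+1).

Definition right_redundant (I : nat) : Prop :=
  forall a b, X a -> X b -> (forall j, j <= 0 -> a j = b j) ->
  f (word a (I%:Z - N%:Z) N.+1) = f (word b (I%:Z - N%:Z) N.+1).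

Definition right_mergible (k : nat) : Prop :=
  forall a b, X a -> X b -> (forall j, j <= 0 -> a j = b j) ->
  (forall j : int, 1 <= j <= k%:Z + 1 ->
     f (word a (j - N%:Z) N.+1) = f (word b (j - N%:Z) N.+1)) ->
  a 1 = b 1.

Definition left_mergible (k : nat) : Prop :=
  forall a b, X a -> X b -> (forall j, 0 <= j -> a j = b j) ->
  (forall j : int, 1 <= j <= k%:Z + 1 ->
     f (word a (- j) N.+1) = f (word b (- j) N.+1)) ->
  a (- 1) = b (- 1).

End Degrees.

(* "Strictly I redundant" for I in N u {oo}, encoded in the extended integers:
   I holds but I+1 does not; oo when every I holds. *)
Definition strict_redundancy (P : nat -> Prop) (I : \bar int) : Prop :=
  match I with
  | (Posz i)%:E => P i /\ ~ P i.+1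
  | +oo%E => forall i, P i
  | _ => False
  end.

(* "Strictly k mergible": k is least such that P k; oo when there is none. *)
Definition strict_mergibility (P : nat -> Prop) (k : \bar int) : Prop :=
  match k with
  | (Posz i)%:E => P i /\ (forall j, P j -> (i <= j)%N)
  | +oo%E => forall i, ~ P i
  | _ => False
  end.

(* The sets below are singletons when phi is an endomorphism of a subshift
   (the value does not depend on f, m, n); [xget] extracts the element and
   the default 0 is never reached in that case. *)
Section DegreesOfEndomorphisms.
Variables (A : choiceType) (X : set (config A)).
Variable phi : config A -> config A.
Local Open Scope ereal_scope.

Definition P_L : \bar int := xget 0
  [set p | exists m n (f : (m + n).+1.-tuple A -> A) I,
     [/\ has_type X phi f, strict_redundancy (left_redundant X f) I
       & p = I - m%:Z%:E]].

Definition P_R : \bar int := xget 0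
  [set p | exists m n (f : (m + n).+1.-tuple A -> A) J,
     [/\ has_type X phi f, strict_redundancy (right_redundant X f) J
       & p = J - n%:Z%:E]].

Definition Q_R : \bar int :=
  if `[< finite_set X >] then +oo else xget 0
  [set q | exists m n (f : (m + n).+1.-tuple A -> A) k,
     [/\ has_type X phi f, strict_mergibility (right_mergible X f) k
       & q = n%:Z%:E - k]].

Definition Q_L : \bar int :=
  if `[< finite_set X >] then +oo else xget 0
  [set q | exists m n (f : (m + n).+1.-tuple A -> A) l,
     [/\ has_type X phi f, strict_mergibility (left_mergible X f) l
       & q = m%:Z%:E - l]].

Definition C_R : \bar int := maxe (- P_L) (- Q_R).

Definition C_L : \bar int := mine P_R Q_L.

End DegreesOfEndomorphisms.

(** * Graphs and textile systems *)

Record digraph := Graph {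
  vertex_of : finType;
  arc_of : finType;
  ini : arc_of -> vertex_of;
  ter : arc_of -> vertex_of }.

Record graph_hom (H G : digraph) := GraphHom {
  hom_arc :> arc_of H -> arc_of G;
  hom_vertex : vertex_of H -> vertex_of G;
  hom_ini : forall e, ini (hom_arc e) = hom_vertex (ini e);
  hom_ter : forall e, ter (hom_arc e) = hom_vertex (ter e) }.

(* X_G *)
Definition paths (G : digraph) : set (config (arc_of G)) :=
  [set a | forall j, ter (a j : arc_of G) = ini (a (j + 1) : arc_of G)].

(* Letter-to-letter map; [letter_map (hom_arc h)] on [paths H] is phi_h. *)
Definition letter_map (A B : choiceType) (h : A -> B) (a : config A) :
    config B := fun j => h (a j).

Definition weakly_left_resolving (H G : digraph) (h : graph_hom H G) : Prop :=
  forall e e' : arc_of H, ter e = ter e' -> h e = h e' -> e = e'.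

Definition weakly_right_resolving (H G : digraph) (h : graph_hom H G) : Prop :=
  forall e e' : arc_of H, ini e = ini e' -> h e = h e' -> e = e'.

Record textile := Textile {
  upper : digraph;
  lower : digraph;
  p_hom : graph_hom upper lower;
  q_hom : graph_hom upper lower }.

Definition textile_LR (T : textile) : Prop :=
  weakly_left_resolving (p_hom T) /\ weakly_right_resolving (q_hom T).

Definition textile_RL (T : textile) : Prop :=
  weakly_right_resolving (p_hom T) /\ weakly_left_resolving (q_hom T).

(* phi = phi_q o (phi_p|Z)^-1.  The requirement phi_p(Z) = X presupposes that
   the letters of X are arcs of the lower graph; [iota], injective on the
   letters of X, is that identification. *)
Definition realized_by (A : choiceType) (X : set (config A))
    (phi : config A -> config A) (T : textile) : Prop :=
  exists (Z : set (config (arc_of (upper T)))) (iota : A -> arc_of (lower T)),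
    let phi_p := letter_map (p_hom T) in
    let phi_q := letter_map (q_hom T) in
    [/\ closed Z, sigma_pow 1 @` Z = Z & Z `<=` @paths (upper T)] /\
    [/\ set_inj (letters X) iota,
        set_inj Z phi_p,
        phi_p @` Z = letter_map iota @` X,
        phi_q @` Z `<=` letter_map iota @` X
      & forall z a, Z z -> X a -> phi_p z = letter_map iota a ->
          phi_q z = letter_map iota (phi a)].

Definition weakly_LR (A : choiceType) (X : set (config A))
    (phi : config A -> config A) : Prop :=
  exists2 T : textile, textile_LR T & realized_by X phi T.

Definition weakly_RL (A : choiceType) (X : set (config A))
    (phi : config A -> config A) : Prop :=
  exists2 T : textile, textile_RL T & realized_by X phi T.

(* phi^[t], as an endomorphism of X^[t], is weakly LR (resp. RL). *)
Definition higher_LR (A : choiceType) (t : nat) (X : set (config A))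
    (phi : config A -> config A) : Prop :=
  weakly_LR (higher_block t X) (higher_map t phi).

Definition higher_RL (A : choiceType) (t : nat) (X : set (config A))
    (phi : config A -> config A) : Prop :=
  weakly_RL (higher_block t X) (higher_map t phi).

(* Main.v *)
Require Import Defs.
From mathcomp Require Import all_boot all_order all_algebra.
From mathcomp Require Import all_classical all_reals all_analysis.
From mathcomp Require Import zify.

Set Implicit Arguments.
Unset Strict Implicit.
Unset Printing Implicit Defensive.

Import Order.TTheory GRing.Theory Num.Theory.
Local Open Scope classical_set_scope.
Local Open Scope ring_scope.

(** Both degrees that enter [C_R] are determination properties of [phi].  That
    [r <= P_L] means that the coordinates [j >= 0] of a point determine the
    coordinates [j >= - r] of its image ([left_causal], [P_L_geP]); that
    [r <= Q_R] means that the coordinates [j <= 0] of a point, together with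
    the coordinates [j <= 1 - r] of its image, determine the coordinate [1] of
    the point ([right_closing], [Q_R_geP]).  Composing [phi] with [sigma^s]
    adds [s] to both degrees, so [C_R <= s] says that [phi \o sigma^s] has both
    properties with [r = 0] ([C_R_leP]).

    These properties make a map weakly LR after passing to blocks.  By
    compactness ([finitely_determined]) they are witnessed by windows of
    bounded width.  Write a point [a] above its image [psi a] and cut this
    two-row array into strips of a width [T] larger than these windows.  Take
    the strips as arcs, joined along their common [T - 1] columns.  A strip is
    determined by its last [T - 1] columns and its first upper letter, since
    causality yields the first lower letter, and by its first [T - 1] columns
    and its last lower letter, since closing yields the last upper letter.
    Therefore the map that reads the first [u] upper letters is weakly
    left-resolving and the one that reads the last [u] lower letters is weakly
    right-resolving; as the two words are [T - u] columns apart, this presents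
    [psi \o sigma^(T - u)] on [u]-blocks ([LR_of_windows]).  Varying [u] and
    [T] gives the whole family of the theorem ([LR_family]).

    In the other direction, two paths of a weakly LR textile system whose upper
    rows agree on a half-line have equal arcs far out on it, because [phi_p] is
    injective on a compact set; the resolving properties propagate this
    equality arc by arc, that of [p] leftwards as long as the upper rows agree,
    and that of [q] rightwards as long as the lower rows agree
    ([weakly_LR_causal_closing]).

    If [s > C_R], both properties hold with [r = 1], and a wide enough vertical
    band of the array formed by a full orbit determines the column on either
    side of it, hence the whole orbit ([causal_closing_expansive]).

    The results on the weakly RL maps follow by reading configurations
    backwards, which exchanges [ini] with [ter], LR with RL, and [sigma] with
    its inverse ([weakly_RL_mirror], [higher_RL_mirror]).

    If [X] is finite, both degrees are infinite and a point is determined by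
    any window of a fixed width, whatever the map; the same strips then work
    for all [s] at once ([LR_of_finite]). *)

(** * Subshifts through finite windows *)

Definition window_eq (A : choiceType) (n : nat) (a b : config A) : Prop :=
  forall j : int, - n%:Z <= j -> j <= n%:Z -> a j = b j.

Lemma window_eq_sym (A : choiceType) n (a b : config A) :
  window_eq n a b -> window_eq n b a.
Proof. by move=> ab j j1 j2; rewrite ab. Qed.

Lemma window_eq_trans (A : choiceType) n (a b c : config A) :
  window_eq n a b -> window_eq n b c -> window_eq n a c.
Proof. by move=> ab bc j j1 j2; rewrite ab // bc. Qed.

Lemma window_eqW (A : choiceType) m n (a b : config A) :
  (m <= n)%N -> window_eq n a b -> window_eq m a b.
Proof. by move=> mn ab j j1 j2; apply: ab; lia. Qed.

Lemma nbhs_coord (A : choiceType) (a : config A) (i : int) :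
  nbhs a [set b : config A | b i = a i].
Proof.
have := @proj_continuous int (fun _ => discrete_topology A) i a.
move=> /(_ [set a i]); rewrite /= nbhs_simpl; apply.
exact: discrete_set1.
Qed.

Definition windows (A : choiceType) (a : config A) : set_system (config A) :=
  [set U | exists n, forall b, window_eq n a b -> U b].

Lemma windows_filter (A : choiceType) (a : config A) : Filter (windows a).
Proof.
split.
- by exists 0%N.
- move=> U V [n nU] [m mV]; exists (maxn n m) => b ab; split.
  + by apply: nU; apply: window_eqW ab; rewrite leq_maxl.
  + by apply: mV; apply: window_eqW ab; rewrite leq_maxr.
- by move=> U V UV [n nU]; exists n => b /nU /UV.
Qed.

(** A window is a finite intersection of cylinders, hence a neighbourhood;
    conversely the filter of windows converges coordinatewise, hence in the
    product topology. *)
Lemma nbhs_windows (A : choiceType) (a : config A) : nbhs a = windows a.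
Proof.
have FW := windows_filter a.
have FN : Filter (nbhs a) := nbhs_filter a.
rewrite predeqE => U; split.
- suff wa : windows a --> a by apply: wa.
  apply/cvg_sup => i.
  apply/(@cvg_image (config A) (discrete_topology A) (fun b => b i)
    (windows a) a FW).
    by rewrite predeqE => c; split => // _; exists (fun _ => c).
  move=> V /nbhs_singleton Vai; exists [set b : config A | V (b i)].
    by exists `|i|%N => b ab /=; rewrite -(ab i) //; lia.
  rewrite predeqE => c; split; first by move=> [b /= Vb <-].
  by move=> Vc; exists (fun _ => c).
- move=> [n nU]; elim: n U nU => [|n IH] U nU.
    apply: filterS (nbhs_coord a 0) => b /= b0; apply: nU => j j1 j2.
    by have -> : j = 0 by lia.
  pose V := [set b | window_eq n a b].
  have ends := @filterI _ _ FN _ _ (nbhs_coord a n.+1%:Z) (nbhs_coord a (- n.+1%:Z)).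
  have aV : nbhs a V by apply: IH.
  apply: (@filterS _ _ FN _ _ _ (@filterI _ _ FN _ _ aV ends)).
  move=> b [/= Vb [b1 b2]]; apply: nU => j j1 j2.
  have [->|jn] := eqVneq j n.+1%:Z; first by [].
  have [->|jn'] := eqVneq j (- n.+1%:Z); first by [].
  by apply: Vb; lia.
Qed.

Lemma closed_windowP (A : choiceType) (X : set (config A)) :
  closed X <-> forall a, (forall n, exists2 b, X b & window_eq n a b) -> X a.
Proof.
split=> [cX a Xa|cX a Xa].
- apply: cX => U; rewrite nbhs_windows => -[n nU].
  by have [b Xb ab] := Xa n; exists b; split => //; exact: nU.
- apply: cX => n; have [|b [Xb ab]] := Xa [set b | window_eq n a b].
    by rewrite nbhs_windows; exists n.
  by exists b.
Qed.

(** The full shift is compact by Tychonoff's theorem, so the sequence has a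
    cluster point in [X]. *)
Lemma cluster_point (A : finType) (X : set (config A)) (u : nat -> config A) :
  closed X -> (forall n, X (u n)) ->
  exists2 x, X x & forall n, exists2 m, (n <= m)%N & window_eq n (u m) x.
Proof.
move=> cX Xu.
have cT : compact [set: config A].
  have := @tychonoff int (fun _ => discrete_topology A) (fun _ => setT).
  have -> : [set f : forall i : int, discrete_topology A |
             forall i, [set: discrete_topology A] (f i)] = setT.
    by rewrite predeqE.
  apply => i; apply: finite_compact; exact: finite_finset.
have cptX : compact X by apply: (subclosed_compact cX cT).
have FF : ProperFilter (u @ \oo) by apply: fmap_proper_filter.
have [|x [Xx clx]] := cptX _ FF.
  by exists 0%N => // n _; exact: Xu.
exists x => // n.
have [||y [[m nm <-] xm]] :=
  clx (u @` [set m | (n <= m)%N]) [set b | window_eq n x b].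
- by exists n => // m nm; exists m.
- by rewrite nbhs_windows; exists n.
- by exists m => //; apply: window_eq_sym.
Qed.

(** The cluster points are taken along a common subsequence, extracted for [u]
    first and then for [v]. *)
Lemma cluster_pair (A : finType) (X : set (config A)) (u v : nat -> config A) :
  closed X -> (forall n, X (u n)) -> (forall n, X (v n)) ->
  exists x y, [/\ X x, X y & forall n, exists m,
    [/\ (n <= m)%N, window_eq n (u m) x & window_eq n (v m) y]].
Proof.
move=> cX Xu Xv; have [x Xx hx] := cluster_point cX Xu.
have {hx} [k hk] : {k : nat -> nat |
    forall n, (n <= k n)%N /\ window_eq n (u (k n)) x}.
  exists (fun n => sval (cid2 (hx n))) => n; by case: cid2.
have [y Xy hy] := cluster_point cX (fun n => Xv (k n)).
exists x, y; split => // n; have [m nm vy] := hy n.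
have [mk ux] := hk m; exists (k m); split => //; first exact: leq_trans nm mk.
exact: window_eqW ux.
Qed.

Definition locally_constant (A : choiceType) (B : Type) (X : set (config A))
    (g : config A -> B) : Prop :=
  forall a, X a -> exists n, forall b, X b -> window_eq n b a -> g b = g a.

(** The form in which compactness turns conditions on half-lines into conditions
    on windows.  Otherwise there are pairs of points that agree in more and more
    of the observables [h], but not in [g]; by continuity a limit of such pairs
    agrees in all of the former and not in the latter. *)
Lemma finitely_determined (A : finType) (B C : Type) (X : set (config A))
    (P : set int) (h : int -> config A -> B) (g : config A -> C) :
  closed X -> (forall j, P j -> locally_constant X (h j)) ->
  locally_constant X g ->
  (forall a b, X a -> X b -> (forall j, P j -> h j a = h j b) -> g a = g b) ->
  exists n : nat, forall a b, X a -> X b ->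
    (forall j, P j -> - n%:Z <= j -> j <= n%:Z -> h j a = h j b) -> g a = g b.
Proof.
move=> cX lh lg det; apply: contrapT => no.
have {no} bad n : {p : config A * config A | [/\ X p.1, X p.2,
    (forall j, P j -> - n%:Z <= j -> j <= n%:Z -> h j p.1 = h j p.2)
    & g p.1 <> g p.2]}.
  apply: cid; apply: contrapT => no'; apply: no; exists n => a b Xa Xb hab.
  by apply: contrapT => gab; apply: no'; exists (a, b); split.
pose u n := (sval (bad n)).1; pose v n := (sval (bad n)).2.
have Xu n : X (u n) by rewrite /u; case: (bad n) => p [].
have Xv n : X (v n) by rewrite /v; case: (bad n) => p [].
have huv n j : P j -> - n%:Z <= j -> j <= n%:Z -> h j (u n) = h j (v n).
  by rewrite /u /v; case: (bad n) => p []/= _ _ + _; apply.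
have guv n : g (u n) <> g (v n).
  by rewrite /u /v; case: (bad n) => p [].
have [x [y [Xx Xy xy]]] := cluster_pair cX Xu Xv.
have gxy : g x = g y.
  apply: det => // j Pj; have [n hn] := lh j Pj x Xx; have [k hk] := lh j Pj y Xy.
  have [m [nm ux vy]] := xy (maxn `|j|%N (maxn n k)).
  rewrite -(hn (u m)) //; last by apply: window_eqW ux; lia.
  by rewrite -(hk (v m)) //; [apply: huv => //; lia|apply: window_eqW vy; lia].
have [n hn] := lg x Xx; have [k hk] := lg y Xy.
have [m [nm ux vy]] := xy (maxn n k).
apply: (guv m); rewrite (hn (u m)) //; last by apply: window_eqW ux; lia.
by rewrite (hk (v m)) //; apply: window_eqW vy; lia.
Qed.

Lemma locally_constant_coord (A : choiceType) (B : Type) (X : set (config A))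
    (f : A -> B) (j : int) : locally_constant X (fun a => f (a j)).
Proof. by move=> a _; exists `|j|%N => b _ ab; rewrite ab //; lia. Qed.

Lemma continuous_locally_constant (A : choiceType) (X : set (config A))
    (phi : config A -> config A) (j : int) :
  {within X, continuous phi} -> locally_constant X (fun a => phi a j).
Proof.
move=> /subspace_continuousP cphi a Xa.
have /= := cphi a Xa _ (nbhs_coord (phi a) j).
rewrite nbhs_simpl /within /= nbhs_windows => -[n hn].
by exists n => b Xb ba; apply: hn => //; exact: window_eq_sym.
Qed.

(** The metric only matters through the uniformity that it induces on [X], for
    which the windows form a basis, [X] being compact. *)
Lemma metric_window (R : realType) (A : finType) (X : set (config A))
    (d : config A -> config A -> R) (n : nat) :
  closed X -> compatible_metric X d ->
  exists2 delta : R, 0 < delta &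
    forall x y, X x -> X y -> d x y <= delta -> window_eq n x y.
Proof.
move=> cX [d0 dE dC dT dnbhs]; apply: contrapT => no.
have {no} bad k : {p : config A * config A | [/\ X p.1, X p.2,
    d p.1 p.2 <= k.+1%:R^-1 & ~ window_eq n p.1 p.2]}.
  apply: cid; apply: contrapT => no'; apply: no.
  exists k.+1%:R^-1 => [|x y Xx Xy dxy]; first by rewrite invr_gt0 ltr0n.
  by apply: contrapT => nxy; apply: no'; exists (x, y); split.
have [|x Xx hx] := @cluster_point _ X (fun k => (sval (bad k)).1) cX.
  by move=> k; case: (bad k) => p [].
have [e e0 he] : exists2 e, 0 < e & forall y, X y -> d x y < e -> window_eq n x y.
  apply/(dnbhs x [set y | window_eq n x y] Xx).
  by rewrite nbhs_windows; exists n.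
have [m hm] : exists m, forall y, X y -> window_eq m x y -> d x y < e / 2.
  have : within X (nbhs x) [set y | d x y < e / 2].
    apply/(dnbhs x _ Xx); exists (e / 2) => //; exact: divr_gt0.
  by rewrite /within /= nbhs_windows => -[m hm]; exists m => y Xy /hm; exact.
(* Beyond the index [K] the distance [k.+1%:R^-1] is less than [e / 2]. *)
pose K := Num.truncn (2 / e).
have [k kK ukx] := hx (maxn m K).
case: (bad k) ukx => -[y z] [/= Xy Xz dyz nyz] ukx; apply: nyz.
have dxy : d x y < e / 2.
  apply: hm => //; apply: window_eq_sym; apply: window_eqW ukx; lia.
have dyz' : d y z < e / 2.
  apply: le_lt_trans dyz _; rewrite invf_plt ?posrE ?divr_gt0 //.
  rewrite invf_div; apply: lt_le_trans (truncnS_gt (2 / e)) _.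
  by rewrite ler_nat ltnS (leq_trans _ kK) // leq_maxr.
apply: (window_eq_trans (b := x)).
  by apply: window_eq_sym; apply: he => //; apply: lt_trans dxy _;
    rewrite ltr_pdivrMr // ltr_pMr // ltr1n.
apply: he => //; apply: le_lt_trans (dT x y z Xx Xy Xz) _.
by rewrite (splitr e) ltrD.
Qed.

(** * Cellular maps and reflection *)

(** A closed shift-invariant set with an endomorphism, its continuity being
    expressed by windows: all that the arguments below use of a subshift, in a
    form that is evidently preserved by shifting and by reflection. *)
Record cellular_map (A : choiceType) (X : set (config A))
    (phi : config A -> config A) : Prop := CellularMap {
  cell_closed : closed X;
  cell_shift : forall s a, X a -> X (sigma_pow s a);
  cell_stable : forall a, X a -> X (phi a);
  cell_comm : forall s a, X a -> phi (sigma_pow s a) = sigma_pow s (phi a);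
  cell_local : forall j, locally_constant X (fun a => phi a j) }.

Lemma sigma_powD (A : choiceType) (s t : int) (a : config A) :
  sigma_pow s (sigma_pow t a) = sigma_pow (s + t) a.
Proof. by apply/funext => j; rewrite /sigma_pow addrA. Qed.

Lemma sigma_pow0 (A : choiceType) (a : config A) : sigma_pow 0 a = a.
Proof. by apply/funext => j; rewrite /sigma_pow addr0. Qed.

Lemma shift_invariant (A : choiceType) (X : set (config A)) s a :
  sigma_pow 1 @` X = X -> X a -> X (sigma_pow s a).
Proof.
move=> sX.
have up b : X b -> X (sigma_pow 1 b) by move=> Xb; rewrite -sX; exists b.
have dn b : X b -> X (sigma_pow (-1) b).
  by rewrite -{1}sX => -[c Xc <-]; rewrite sigma_powD addNr sigma_pow0.
case: (intP s) => [|n|n]; first by rewrite sigma_pow0.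
- elim: n => [|n IH] Xa; first exact: up.
  by rewrite -(_ : 1 + n.+1%:Z = n.+2%:Z) // -sigma_powD; apply/up/IH.
- elim: n => [|n IH] Xa; first exact: dn.
  have -> : - n.+2%:Z = -1 + - n.+1%:Z by lia.
  by rewrite -sigma_powD; apply: dn; apply: IH.
Qed.

Lemma endomorphism_cellular (A : choiceType) (X : set (config A)) phi :
  subshift X -> endomorphism X phi -> cellular_map X phi.
Proof.
move=> [cX sX] [cphi phiX comm]; have shX s a := @shift_invariant A X s a sX.
split => //.
- by move=> a Xa; apply: phiX; exists a.
- have pos n a : X a -> phi (sigma_pow n%:Z a) = sigma_pow n%:Z (phi a).
    move=> Xa; elim: n => [|n IH]; first by rewrite !sigma_pow0.
    rewrite -(_ : 1 + n%:Z = n.+1%:Z) // -!(sigma_powD 1) comm ?IH //.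
    exact: shX.
  move=> s; case: (intP s) => [|n|n] a Xa; [exact: pos 0%N a Xa|exact: pos|].
  have Xb : X (sigma_pow (- n.+1%:Z) a) by exact: shX.
  rewrite -{2}(sigma_pow0 a) -(addrN n.+1%:Z) -(sigma_powD n.+1%:Z) (pos n.+1) //.
  by rewrite sigma_powD addNr sigma_pow0.
- by move=> j; apply: continuous_locally_constant.
Qed.

Lemma cellular_shift (A : choiceType) (X : set (config A)) phi s :
  cellular_map X phi -> cellular_map X (phi \o sigma_pow s).
Proof.
move=> [cX shX stX comm loc]; split => //=.
- by move=> a Xa; apply/stX/shX.
- by move=> t a Xa; rewrite sigma_powD addrC -sigma_powD comm //; apply: shX.
- move=> j a Xa; have [n hn] := loc (j + s) a Xa.
  exists n => b Xb ab; rewrite !comm //; exact: hn.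
Qed.

(** The mirror image exchanges left and right, hence LR and RL, and turns the
    shift into its inverse. *)
Definition mirror (A : choiceType) (a : config A) : config A := fun j => a (- j).

Definition mirror_set (A : choiceType) (X : set (config A)) : set (config A) :=
  [set a | X (mirror a)].

Definition mirror_map (A : choiceType) (phi : config A -> config A) :
  config A -> config A := fun a => mirror (phi (mirror a)).

Lemma mirrorK (A : choiceType) (a : config A) : mirror (mirror a) = a.
Proof. by apply/funext => j; rewrite /mirror opprK. Qed.

Lemma mirror_setK (A : choiceType) (X : set (config A)) :
  mirror_set (mirror_set X) = X.
Proof. by rewrite predeqE => a; rewrite /mirror_set /= mirrorK. Qed.

Lemma mirror_mapK (A : choiceType) (phi : config A -> config A) :
  mirror_map (mirror_map phi) = phi.
Proof. by apply/funext => a; rewrite /mirror_map !mirrorK. Qed.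

Lemma mirror_sigma (A : choiceType) s (a : config A) :
  mirror (sigma_pow s a) = sigma_pow (- s) (mirror a).
Proof. by apply/funext => j; rewrite /mirror /sigma_pow; congr a; lia. Qed.

Lemma mirror_map_sigma (A : choiceType) (phi : config A -> config A) s :
  mirror_map (phi \o sigma_pow s) = mirror_map phi \o sigma_pow (- s).
Proof. by apply/funext => a; rewrite /mirror_map /= mirror_sigma opprK. Qed.

Lemma mirror_window (A : choiceType) n (a b : config A) :
  window_eq n a b -> window_eq n (mirror a) (mirror b).
Proof. by move=> ab j j1 j2; apply: ab; lia. Qed.

Lemma closed_mirror (A : choiceType) (X : set (config A)) :
  closed X -> closed (mirror_set X).
Proof.
move=> cX; apply/closed_windowP => a ha; apply: (closed_windowP X).1 => // n.
by have [b Xb ab] := ha n; exists (mirror b) => //; apply: mirror_window.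
Qed.

Lemma cellular_mirror (A : choiceType) (X : set (config A)) phi :
  cellular_map X phi -> cellular_map (mirror_set X) (mirror_map phi).
Proof.
move=> [cX shX stX comm loc]; split.
- exact: closed_mirror.
- by move=> s a Xa; rewrite /mirror_set /= mirror_sigma; apply: shX.
- by move=> a Xa; rewrite /mirror_set /mirror_map /= mirrorK; apply: stX.
- by move=> s a Xa; rewrite /mirror_map mirror_sigma comm // mirror_sigma opprK.
- move=> j a Xa; have [n hn] := loc (- j) _ Xa.
  by exists n => b Xb ab; apply: hn => //; apply: mirror_window.
Qed.

Lemma finite_mirror (A : choiceType) (X : set (config A)) :
  finite_set (mirror_set X) <-> finite_set X.
Proof.
have fin (Y : set (config A)) : finite_set Y -> finite_set (mirror_set Y).
  move=> fY; apply: sub_finite_set (finite_image (@mirror A) fY) => a Ya.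
  by exists (mirror a) => //; rewrite mirrorK.
by split => /fin; rewrite ?mirror_setK.
Qed.

(** * Causality and closing *)

(** Asking for the single coordinate [- r] suffices: the later ones follow by
    shifting, since a longer right half-line is then known. *)
Definition left_causal (A : choiceType) (X : set (config A))
    (phi : config A -> config A) (r : int) : Prop :=
  forall a b, X a -> X b -> (forall j, 0 <= j -> a j = b j) ->
  phi a (- r) = phi b (- r).

(** With this formulation every [r] qualifies when [X] is finite, in accordance
    with the convention that [Q_R] is then infinite. *)
Definition right_closing (A : choiceType) (X : set (config A))
    (phi : config A -> config A) (r : int) : Prop :=
  forall a b, X a -> X b -> (forall j, j <= 0 -> a j = b j) ->
  (forall j, j <= 1 - r -> phi a j = phi b j) -> a 1 = b 1.

Section Cellular.
Variables (A : finType) (X : set (config A)) (phi : config A -> config A).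
Hypothesis cell : cellular_map X phi.

Lemma left_causal_at r i a b : left_causal X phi r -> X a -> X b ->
  (forall j, i <= j -> a j = b j) -> phi a (i - r) = phi b (i - r).
Proof.
move=> lc Xa Xb ab.
have := lc _ _ (cell_shift cell i Xa) (cell_shift cell i Xb).
rewrite !(cell_comm cell) // /sigma_pow addrC; apply.
by move=> j j0; apply: ab; lia.
Qed.

Lemma left_causalW r r' : r' <= r -> left_causal X phi r -> left_causal X phi r'.
Proof.
move=> rr lc a b Xa Xb ab; rewrite (_ : - r' = (r - r') - r); last by lia.
by apply: left_causal_at => // j j0; apply: ab; lia.
Qed.

Lemma right_closingW r r' :
  r' <= r -> right_closing X phi r -> right_closing X phi r'.
Proof. by move=> rr rc a b Xa Xb ab pab; apply: rc => // j j1; apply: pab; lia. Qed.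

Lemma left_causal_window r : left_causal X phi r ->
  exists n : nat, forall a b i, X a -> X b ->
    (forall j, i <= j -> j <= i + n%:Z -> a j = b j) ->
    phi a (i - r) = phi b (i - r).
Proof.
move=> lc.
have [||n hn] := @finitely_determined A A A X (fun j => 0 <= j)
  (fun j a => a j) (fun a => phi a (- r)) (cell_closed cell) _ _ lc.
- by move=> j _; apply: (@locally_constant_coord A A X id).
- exact: (cell_local cell).
exists n => a b i Xa Xb ab.
have := hn _ _ (cell_shift cell i Xa) (cell_shift cell i Xb).
rewrite !(cell_comm cell) // /sigma_pow addrC; apply.
by move=> j j0 _ jn; apply: ab; lia.
Qed.

Lemma right_closing_window r : right_closing X phi r ->
  exists n : nat, forall a b i, X a -> X b ->
    (forall j, i - n%:Z <= j -> j <= i -> a j = b j) ->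
    (forall j, i - n%:Z <= j -> j <= i + 1 - r -> phi a j = phi b j) ->
    a (i + 1) = b (i + 1).
Proof.
move=> rc.
(* The two half-lines end at different places; [None] masks the coordinates
   beyond the end of each, so that a single family [h] covers both. *)
pose h (j : int) (a : config A) : option A * option A :=
  (if j <= 0 then Some (a j) else None,
   if j <= 1 - r then Some (phi a j) else None).
have [|||n hn] := @finitely_determined A _ A X setT h
   (fun a => a 1) (cell_closed cell).
- move=> j _ a Xa; have [n hn] := cell_local cell j Xa.
  exists (maxn n `|j|%N) => b Xb ba; rewrite /h hn ?ba //; try lia.
  by apply: window_eqW ba; lia.
- exact: (@locally_constant_coord A A X id).
- move=> a b Xa Xb hab; apply: rc => // j j1.
  + by have := hab j I; rewrite /h j1 => -[].
  + by have := hab j I; rewrite /h j1 => -[].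
exists n => a b i Xa Xb ab pab.
have := hn _ _ (cell_shift cell i Xa) (cell_shift cell i Xb).
rewrite /sigma_pow (addrC 1); apply => j _ j1 j2.
rewrite /h !(cell_comm cell) // /sigma_pow; congr pair.
  by case: ifP => // j0; rewrite ab //; lia.
by case: ifP => // j0; rewrite pab //; lia.
Qed.

End Cellular.

(** * Finite subshifts *)

Section Finiteness.
Variables (A : finType) (X : set (config A)).
Hypothesis cX : closed X.
Hypothesis shX : forall s a, X a -> X (sigma_pow s a).

(** Points of a finite subshift are periodic, two of them with a common period;
    a left half-line contains a full period. *)
Lemma finite_left_determined (a b : config A) : finite_set X -> X a -> X b ->
  (forall j, j <= 0 -> a j = b j) -> a 1 = b 1.
Proof.
move=> fX Xa Xb ab.
pose u (k : nat) := (sigma_pow (- k%:Z) a, sigma_pow (- k%:Z) b).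
have [k [l [kl [ua ub]]]] : exists k l, (k < l)%N /\
   sigma_pow (- k%:Z) a = sigma_pow (- l%:Z) a /\
   sigma_pow (- k%:Z) b = sigma_pow (- l%:Z) b.
  apply: contrapT => no; apply: infinite_nat.
  have uinj : {in [set: nat] &, injective u}.
    move=> k l _ _ [ua ub]; apply: contrapT => kl; apply: no.
    have [kl'|lk|//] := ltngtP k l; first by exists k, l.
    by exists l, k.
  have := finite_setX fX fX.
  have /sub_finite_set : u @` setT `<=` X `*` X.
    by move=> _ [k _ <-]; split; apply: shX.
  move=> /[apply] fu.
  by rewrite -(eq_finite_set (inj_card_eq uinj)).
have per (c : config A) : sigma_pow (- k%:Z) c = sigma_pow (- l%:Z) c ->
    c 1 = c (1 - (l%:Z - k%:Z)).
  move=> /(congr1 (fun d => d (1 + k%:Z))); rewrite /sigma_pow.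
  by rewrite addrK => ->; congr c; lia.
by rewrite (per a) // (per b) // ab //; lia.
Qed.

(** A determination of the next letter by a window is iterated letter by letter
    to the right. *)
Lemma left_determined_window :
  (forall a b, X a -> X b -> (forall j, j <= 0 -> a j = b j) -> a 1 = b 1) ->
  exists n : nat, forall a b i, X a -> X b ->
    (forall j, i <= j -> j <= i + n%:Z -> a j = b j) ->
    forall j, i <= j -> a j = b j.
Proof.
move=> det.
have [||n hn] := @finitely_determined A A A X (fun j => j <= 0)
  (fun j a => a j) (fun a => a 1) cX _ _ det.
- by move=> j _; apply: (@locally_constant_coord A A X id).
- exact: (@locally_constant_coord A A X id).
exists n => a b i Xa Xb ab j j1.
have [k] : exists k : nat, j <= i + n%:Z + k%:Z by exists `|j - i|%N; lia.
elim: k j j1 => [|k IH] j j1 j2; first by apply: ab; lia.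
have [->|jk] := eqVneq j (i + n%:Z + k%:Z + 1); last by apply: IH; lia.
have := hn _ _ (shX (i + n%:Z + k%:Z) Xa) (shX (i + n%:Z + k%:Z) Xb).
rewrite /sigma_pow (addrC 1); apply => l l0 l1 l2; apply: IH; lia.
Qed.

(** Windows of some fixed length [n.+1] already determine everything to their
    right, so for each
    position there are at most as many different right parts of points as there
    are words; pushing the position to the left bounds the number of
    points. *)
Lemma left_determined_finite :
  (forall a b, X a -> X b -> (forall j, j <= 0 -> a j = b j) -> a 1 = b 1) ->
  finite_set X.
Proof.
move=> /left_determined_window[n right].
pose w (k : nat) (a : config A) := word a (- k%:Z) n.+1.
have winj k a b : X a -> X b -> w k a = w k b ->
    forall j, - k%:Z <= j -> a j = b j.
  move=> Xa Xb wab; apply: right => // j j1 j2.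
  have jn : (`|(j + k%:Z)%R|%N < n.+1)%N by lia.
  move/(congr1 (fun t => tnth t (Ordinal jn))): wab.
  have e : - k%:Z + `|(j + k%:Z)%R|%N%:Z = j by lia.
  by rewrite !tnth_mktuple /= e.
apply: contrapT => /infiniteP/card_leP/unsquash f.
pose x (i : nat) : config A := val (f (SigSub (mem_set (I : [set: nat] i)))).
have Xx i : X (x i) by exact: set_mem (valP _).
have xinj i j : i != j -> exists k, forall l, (k <= l)%N -> w l (x i) != w l (x j).
  move=> ij; apply: contrapT => no; move/eqP: ij; apply.
  suff /val_inj/(@inj _ _ _ f) : x i = x j.
    by rewrite !inE => /(_ Logic.I Logic.I) [].
  apply/funext => c.
  apply: contrapT => xc; apply: no; exists `|c|%N => l cl.
  by apply/eqP => /(winj _ _ _ (Xx i) (Xx j)) /(_ c) xx; apply: xc; apply: xx; lia.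
(* One point more than there are words of length [n.+1]. *)
pose M := #|{: n.+1.-tuple A}|.+1.
have [k hk] : exists k, forall i j : 'I_M, i != j -> w k (x i) != w k (x j).
  have xinj' (i j : 'I_M) :
      {k | i != j -> forall l, (k <= l)%N -> w l (x i) != w l (x j)}.
    apply: cid; have [->|ij] := eqVneq i j; first by exists 0%N.
    by have [k hk] := xinj i j ij; exists k.
  exists (\max_(p : 'I_M * 'I_M) sval (xinj' p.1 p.2))%N => i j ij.
  apply: (svalP (xinj' i j)) => //.
  exact: (@leq_bigmax _ (fun p : 'I_M * 'I_M => sval (xinj' p.1 p.2)) (i, j)).
have winj' : injective (fun i : 'I_M => w k (x i)).
  by move=> i j /eqP wij; apply: contrapT => /eqP /hk; rewrite wij.
by have := leq_card _ winj'; rewrite card_ord ltnn.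
Qed.

End Finiteness.

(** In a finite subshift half-lines on both sides determine points, so a window
    determines a point to its right and then to its left. *)
Lemma finite_window (A : finType) (X : set (config A)) :
  closed X -> (forall s a, X a -> X (sigma_pow s a)) -> finite_set X ->
  exists n : nat, forall a b i, X a -> X b ->
    (forall j, i <= j -> j <= i + n%:Z -> a j = b j) -> a = b.
Proof.
move=> cX shX fX.
have [n hn] := left_determined_window cX shX
  (fun a b => finite_left_determined shX fX).
have shm s a : mirror_set X a -> mirror_set X (sigma_pow s a).
  by rewrite /mirror_set /= mirror_sigma; apply: shX.
exists n => a b i Xa Xb /(hn a b i Xa Xb) ab; apply/funext => j.
have [k] : exists k : nat, i - k%:Z <= j by exists `|j - i|%N; lia.
elim: k j => [|k IH] j jk; first by apply: ab; lia.
have [->|jk'] := eqVneq j (i - k.+1%:Z); last by apply: IH; lia.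
have := @finite_left_determined _ _ shm
  (mirror (sigma_pow (i - k%:Z) a)) (mirror (sigma_pow (i - k%:Z) b)).
rewrite /mirror_set /= !mirrorK /mirror /sigma_pow.
rewrite (_ : - 1 + (i - k%:Z) = i - k.+1%:Z); last lia.
apply; first by apply/finite_mirror.
- exact: shX.
- exact: shX.
- by move=> l l0; apply: IH; lia.
Qed.

(** * The degrees as determination properties *)

Lemma strict_redundancy_ex (P : nat -> Prop) :
  P 0%N -> exists I, strict_redundancy P I.
Proof.
move=> P0; have [all|/existsNP[i nPi]] := pselect (forall i, P i).
  by exists +oo%E.
have [j [Pj nPj]] : exists j, P j /\ ~ P j.+1.
  apply: contrapT => no; apply: nPi; elim: i => // i IH.
  by apply: contrapT => nP; apply: no; exists i.
by exists (j%:Z%:E).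
Qed.

Lemma strict_mergibility_ex (P : nat -> Prop) : exists k, strict_mergibility P k.
Proof.
have [[i Pi]|no] := pselect (exists i, P i); last first.
  by exists +oo%E => i Pi; apply: no; exists i.
have ex : exists i, `[< P i >] by exists i; apply/asboolP.
exists ((ex_minn ex)%:Z%:E); case: ex_minnP => k /asboolP Pk kmin.
by split => // j Pj; apply: kmin; apply/asboolP.
Qed.

(** The degrees [P_L] and [P_R] are cuts: if the redundancy of a rule is the
    trace of a downward closed property [D] of integers, shifted by [m], then
    the degree bounds exactly the integers satisfying [D]. *)
Lemma strict_redundancy_le (P : nat -> Prop) (D : int -> Prop) (m : nat) I :
  P 0%N -> (forall i, P i <-> D (i%:Z - m%:Z)) ->
  (forall r r', r' <= r -> D r -> D r') ->
  strict_redundancy P I ->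
  forall r : int, (r%:E <= I - m%:Z%:E)%E <-> D r.
Proof.
move=> P0 PD Dmono; case: I => [[i|//]| |//] /=.
- move=> [/PD Di /PD nDi] r; rewrite -EFinB lee_fin; split.
    by move=> ri; apply: Dmono Di.
  move=> Dr; rewrite leNgt; apply/negP => ri; apply: nDi.
  by apply: Dmono Dr; lia.
- move=> all r; rewrite addye // leey; split => // _.
  by apply: (Dmono ((`|r|%N + m)%N%:Z - m%:Z) _ _ ((PD _).1 (all _))); lia.
Qed.

(** The same for [Q_R] and [Q_L].  Mergibility starts at 0 and so sees [D] only
    up to [n]; hence the assumption that [D] fails beyond [n]. *)
Lemma strict_mergibility_le (P : nat -> Prop) (D : int -> Prop) (n : nat) k :
  (forall i, P i <-> D (n%:Z - i%:Z)) ->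
  (forall r r', r' <= r -> D r -> D r') -> (forall r, n%:Z < r -> ~ D r) ->
  strict_mergibility P k ->
  forall r : int, (r%:E <= n%:Z%:E - k)%E <-> D r.
Proof.
move=> PD Dmono Dn; case: k => [[k|//]| |//] /=.
- move=> [/PD Dk kmin] r; rewrite -EFinB lee_fin; split.
    by move=> ri; apply: Dmono Dk.
  move=> Dr; have [rn|nr] := leP r n%:Z; last by case: (Dn r).
  have : (k <= `|n%:Z - r|)%N by apply/kmin/PD; apply: Dmono Dr; lia.
  lia.
- move=> none r; rewrite addeNy //; split => // Dr; exfalso.
  apply: (none `|n%:Z - r|%N); apply/PD; apply: Dmono Dr; lia.
Qed.

Section Degrees.
Variables (A : finType) (X : set (config A)) (phi : config A -> config A).
Hypothesis x0 : A.
Hypothesis cell : cellular_map X phi.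

Let cX := cell_closed cell.

Lemma word_sigma (s j : int) k (a : config A) :
  word (sigma_pow s a) j k = word a (j + s) k.
Proof. by apply: eq_from_tnth => i; rewrite !tnth_mktuple /sigma_pow addrAC. Qed.

(** Curtis-Hedlund-Lyndon: by compactness the coordinate at 0 of the image
    depends on a bounded window only. *)
Lemma has_type_ex : exists m n (f : (m + n).+1.-tuple A -> A), has_type X phi f.
Proof.
have [||n hn] := @finitely_determined A A A X setT
  (fun j a => a j) (fun a => phi a 0) cX _ (@cell_local _ _ _ cell 0).
- by move=> j _; apply: (@locally_constant_coord A A X id).
- by move=> a b Xa Xb ab; congr (phi _ 0); apply/funext => j; apply: ab.
pose W (a : config A) := word a (- n%:Z) (n + n).+1.
exists n, n, (fun w => xget x0 [set c : A | exists2 a, X a & W a = w /\ phi a 0 = c]).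
have valE a j : X a ->
  xget x0 [set c : A | exists2 b, X b & W b = word a (j - n%:Z) (n + n).+1
    /\ phi b 0 = c] = phi a j.
  move=> Xa; have Xs := cell_shift cell j Xa.
  have Ws : W (sigma_pow j a) = word a (j - n%:Z) (n + n).+1.
    by rewrite /W word_sigma addrC.
  have ps : phi (sigma_pow j a) 0 = phi a j.
    by rewrite (cell_comm cell) // /sigma_pow add0r.
  rewrite -ps -Ws; case: xgetP => [c _ [b Xb [Wb <-]]|/(_ (phi (sigma_pow j a) 0))].
    apply: hn => // i _ i1 i2.
    have lt : (`|(i + n%:Z)%R|%N < (n + n).+1)%N by lia.
    move/(congr1 (fun t => tnth t (Ordinal lt))): Wb; rewrite !tnth_mktuple /=.
    by have -> : - n%:Z + `|(i + n%:Z)%R|%N%:Z = i by lia.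
  by case; exists (sigma_pow j a).
split=> [a Xa|a Xa]; last by apply/funext => j; rewrite valE.
rewrite (_ : (fun j => _) = sigma_pow n%:Z (phi a)).
  by apply: (cell_shift cell); apply: (cell_stable cell).
apply/funext => j; rewrite /sigma_pow -valE //.
by rewrite addrK.
Qed.

Lemma has_type_word m n (f : (m + n).+1.-tuple A -> A) a j : has_type X phi f ->
  X a -> f (word a j (m + n).+1) = phi a (j + m%:Z).
Proof. by move=> [_ hf] Xa; rewrite hf // addrK. Qed.

Lemma has_type_local m n (f : (m + n).+1.-tuple A -> A) a b j :
  has_type X phi f -> X a -> X b ->
  (forall i, j - m%:Z <= i -> i <= j + n%:Z -> a i = b i) -> phi a j = phi b j.
Proof.
move=> [_ hf] Xa Xb ab; rewrite !hf //; congr f.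
by apply: eq_from_tnth => i; rewrite !tnth_mktuple; apply: ab; case: i => i /=; lia.
Qed.

Lemma P_L_geP (r : int) : (r%:E <= P_L X phi)%E <-> left_causal X phi r.
Proof.
rewrite /P_L; case: xgetP => [p _ [m [n [f [I [tf sI ->]]]]]|none].
  apply: (strict_redundancy_le _ _ _ sI).
  - move=> a b Xa Xb ab; rewrite !(has_type_word _ tf) //.
    by apply: (has_type_local tf) => // i i1 _; apply: ab; lia.
  - have e i : - (i%:Z - m%:Z) = - i%:Z + m%:Z :> int by lia.
    by move=> i; split=> h a b Xa Xb ab; move: (h a b Xa Xb ab);
      rewrite !(has_type_word _ tf) // e.
  - by move=> s s' ss; apply: left_causalW.
have [m [n [f tf]]] := has_type_ex.
have [I sI] : exists I, strict_redundancy (left_redundant X f) I.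
  apply: strict_redundancy_ex => a b Xa Xb ab; rewrite !(has_type_word _ tf) //.
  by apply: (has_type_local tf) => // i i1 _; apply: ab; lia.
by case: (none (I - m%:Z%:E)%E); exists m, n, f, I.
Qed.

Lemma P_R_geP (r : int) :
  (r%:E <= P_R X phi)%E <-> left_causal (mirror_set X) (mirror_map phi) r.
Proof.
have lcE s : left_causal (mirror_set X) (mirror_map phi) s <->
    forall a b, X a -> X b -> (forall j, j <= 0 -> a j = b j) -> phi a s = phi b s.
  split=> h a b Xa Xb ab.
    have := h (mirror a) (mirror b); rewrite /mirror_set /mirror_map /= !mirrorK.
    rewrite /mirror opprK; apply => // j j0; apply: ab; lia.
  rewrite /mirror_map {1 3}/mirror opprK; apply: h => // j j0.
  by apply: ab; lia.
rewrite /P_R; case: xgetP => [p _ [m [n [f [I [tf sI ->]]]]]|none].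
  have e i : i%:Z - (m + n)%:Z + m%:Z = i%:Z - n%:Z :> int by lia.
  apply: (strict_redundancy_le _ _ _ sI).
  - move=> a b Xa Xb ab; rewrite !(has_type_word _ tf) //.
    by apply: (has_type_local tf) => // i _ i1; apply: ab; lia.
  - by move=> i; rewrite lcE; split=> h a b Xa Xb ab; move: (h a b Xa Xb ab);
      rewrite !(has_type_word _ tf) // e.
  - by move=> s s' ss; apply: left_causalW => //; exact: cellular_mirror.
have [m [n [f tf]]] := has_type_ex.
have [I sI] : exists I, strict_redundancy (right_redundant X f) I.
  apply: strict_redundancy_ex => a b Xa Xb ab; rewrite !(has_type_word _ tf) //.
  by apply: (has_type_local tf) => // i _ i1; apply: ab; lia.
by case: (none (I - n%:Z%:E)%E); exists m, n, f, I.
Qed.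

Lemma right_closing_finite r : finite_set X -> right_closing X phi r.
Proof.
move=> fX a b Xa Xb ab _.
exact: (finite_left_determined (cell_shift cell) fX Xa Xb ab).
Qed.

(** If [n < r], the required agreement of the images already follows from that
    of the points, so left half-lines determine points. *)
Lemma right_closing_bounded m n (f : (m + n).+1.-tuple A -> A) r :
  has_type X phi f -> ~ finite_set X -> n%:Z < r -> ~ right_closing X phi r.
Proof.
move=> tf iX nr rc; apply: iX.
apply: (left_determined_finite cX (cell_shift cell)) => a b Xa Xb ab.
apply: rc => // j j1; apply: (has_type_local tf) => // i _ i1.
by apply: ab; lia.
Qed.

Lemma Q_R_geP (r : int) : (r%:E <= Q_R X phi)%E <-> right_closing X phi r.
Proof.
rewrite /Q_R; case: ifP => [/asboolP fX|/asboolP iX].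
  by rewrite leey; split => // _; exact: right_closing_finite.
case: xgetP => [p _ [m [n [f [k [tf sk ->]]]]]|none].
  apply: (strict_mergibility_le _ _ _ sk).
  - have e (j : int) : j - (m + n)%:Z + m%:Z = j - n%:Z :> int by lia.
    move=> i; split=> h a b Xa Xb ab pab; apply: h => // j j1.
    + rewrite !(has_type_word _ tf) // e; apply: pab; lia.
    (* Up to [- n] the images agree because the points do. *)
    + have [jn|nj] := leP j (- n%:Z).
        by apply: (has_type_local tf) => // l _ l1; apply: ab; lia.
      have := pab (j + n%:Z); rewrite !(has_type_word _ tf) // e addrK; apply.
      lia.
  - by move=> s s' ss; apply: right_closingW.
  - by move=> s ns; apply: (right_closing_bounded tf).
have [m [n [f tf]]] := has_type_ex.
have [k sk] := strict_mergibility_ex (right_mergible X f).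
by case: (none (n%:Z%:E - k)%E); exists m, n, f, k.
Qed.

End Degrees.

Section MirrorDegrees.
Variables (A : finType) (X : set (config A)) (phi : config A -> config A).
Hypothesis x0 : A.
Hypothesis cell : cellular_map X phi.

Lemma Q_L_geP (r : int) :
  (r%:E <= Q_L X phi)%E <-> right_closing (mirror_set X) (mirror_map phi) r.
Proof.
have cm := cellular_mirror cell.
have rcE s : right_closing (mirror_set X) (mirror_map phi) s <->
    forall a b, X a -> X b -> (forall j, 0 <= j -> a j = b j) ->
    (forall j, s - 1 <= j -> phi a j = phi b j) -> a (-1) = b (-1).
  split=> h a b Xa Xb ab pab.
    have := h (mirror a) (mirror b); rewrite /mirror_set /mirror_map /= !mirrorK.
    by apply => // j j0; [apply: ab|apply: pab]; lia.
  have := h _ _ Xa Xb; rewrite /mirror opprK; apply => j j0.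
    by apply: ab; lia.
  have := pab (- j); rewrite /mirror_map {1 3}/mirror opprK; apply; lia.
rewrite /Q_L; case: ifP => [/asboolP fX|/asboolP iX].
  rewrite leey; split => // _; apply: (right_closing_finite cm).
  by apply/finite_mirror.
case: xgetP => [p _ [m [n [f [k [tf sk ->]]]]]|none].
  apply: (strict_mergibility_le _ _ _ sk).
  - move=> i; rewrite rcE; split=> h a b Xa Xb ab pab; apply: h => // j j1.
    + rewrite !(has_type_word _ tf) //; apply: pab; lia.
    + have [jm|mj] := leP m%:Z j.
        by apply: (has_type_local tf) => // l l1 _; apply: ab; lia.
      have := pab (m%:Z - j); rewrite !(has_type_word _ tf) // opprB subrK; apply.
      lia.
  - by move=> s s' ss; apply: right_closingW.
  - move=> s ns; rewrite rcE => h; apply: iX; apply/finite_mirror.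
    apply: (left_determined_finite (cell_closed cm) (cell_shift cm)).
    move=> a b Xa Xb ab; apply: (h _ _ Xa Xb) => j j1; first by apply: ab; lia.
    by apply: (has_type_local tf) => // i i1 _; apply: ab; lia.
have [m [n [f tf]]] := has_type_ex x0 cell.
have [k sk] := strict_mergibility_ex (left_mergible X f).
by case: (none (m%:Z%:E - k)%E); exists m, n, f, k.
Qed.

Lemma C_R_leP (s : int) : (C_R X phi <= s%:E)%E <->
  left_causal X phi (- s) /\ right_closing X phi (- s).
Proof.
rewrite -(P_L_geP x0 cell) -(Q_R_geP x0 cell) /C_R ge_max.
by rewrite (leeNl (P_L X phi)) (leeNl (Q_R X phi)) -EFinN; split => /andP.
Qed.

Lemma C_L_geP (s : int) : (s%:E <= C_L X phi)%E <->
  left_causal (mirror_set X) (mirror_map phi) s /\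
  right_closing (mirror_set X) (mirror_map phi) s.
Proof.
by rewrite -P_R_geP // -Q_L_geP // /C_L le_min; split => /andP.
Qed.

End MirrorDegrees.

(** * Textile systems from causality and closing *)

Lemma letter_map_id (A : choiceType) (a : config A) : letter_map id a = a.
Proof. by apply/funext. Qed.

(** The resolving conditions concern the vertices of the upper graph only, so
    the lower graph may have a single vertex. *)
Definition bouquet (B : finType) : digraph :=
  @Graph unit B (fun=> tt) (fun=> tt).

Definition hom_bouquet (G : digraph) (B : finType) (f : arc_of G -> B) :
    graph_hom G (bouquet B) :=
  @GraphHom G (bouquet B) f (fun=> tt) (fun=> erefl) (fun=> erefl).

Definition strip (A : choiceType) (psi : config A -> config A) (k : nat)
    (a : config A) (j : int) : {ffun 'I_k -> A * A} :=
  [ffun i : 'I_k => (a (j + i%:Z), psi a (j + i%:Z))].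

Section Strips.
Variables (A : finType) (X : set (config A)) (psi : config A -> config A).
Hypothesis cell : cellular_map X psi.
Variable T : nat.

Let arc := {w : {ffun 'I_T.+1 -> A * A} |
  `[< exists2 a, X a & w = strip psi T.+1 a 0 >]}.

Definition strip_graph : digraph :=
  @Graph {ffun 'I_T -> A * A} arc
    (fun e => [ffun i => val e (widen_ord (leqnSn T) i)])
    (fun e => [ffun i => val e (lift ord0 i)]).

Lemma strip_sigma k a i j : X a ->
  strip psi k (sigma_pow i a) j = strip psi k a (i + j).
Proof.
move=> Xa; apply/ffunP => l; rewrite !ffunE (cell_comm cell) // /sigma_pow.
by congr (a _, psi a _); lia.
Qed.

Lemma strip_arcP a j : X a ->
  `[< exists2 b, X b & strip psi T.+1 a j = strip psi T.+1 b 0 >].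
Proof.
move=> Xa; apply/asboolP; exists (sigma_pow j a); first exact: (cell_shift cell).
by rewrite strip_sigma // addr0.
Qed.

Definition strip_arc a j (Xa : X a) : arc :=
  exist _ (strip psi T.+1 a j) (strip_arcP j Xa).

Definition strip_path : set (config (arc_of strip_graph)) :=
  [set z | exists2 a, X a &
    forall j, val (z j : arc) = strip psi T.+1 a j].

Lemma strip_path_closed : closed strip_path.
Proof.
apply/closed_windowP => z hz.
have {hz} u n : {a | X a /\
   forall j : int, - n%:Z <= j -> j <= n%:Z -> val (z j : arc) = strip psi T.+1 a j}.
  apply: cid; have [y [a Xa ya] zy] := hz n.
  by exists a; split => // j j1 j2; rewrite zy.
have [|a Xa ha] := @cluster_point _ X (fun n => sval (u n)) (cell_closed cell).
  by move=> n; case: (u n) => b [].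
exists a => // j; apply/ffunP => i; rewrite ffunE.
have [n hn] := cell_local cell (j + i%:Z) Xa.
have [m nm] := ha (maxn n (maxn `|j|%N `|(j + i%:Z)%R|%N)).
case: (u m) => b [Xb zb] /= ba.
rewrite zb ?ffunE; try lia.
congr pair; first by apply: ba; lia.
by apply: hn => //; apply: window_eqW ba; lia.
Qed.

Lemma strip_path_shift : sigma_pow 1 @` strip_path = strip_path.
Proof.
have sh s z : strip_path z -> strip_path (sigma_pow s z).
  move=> [a Xa za]; exists (sigma_pow s a); first exact: (cell_shift cell).
  by move=> j; rewrite /sigma_pow za strip_sigma // addrC.
rewrite predeqE => z; split=> [[y /sh + <-]|Zz]; first exact.
exists (sigma_pow (-1) z); first exact: sh.
by rewrite sigma_powD addrN sigma_pow0.
Qed.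

Lemma strip_path_paths : strip_path `<=` @paths strip_graph.
Proof.
move=> z [a Xa za] j; rewrite /=; apply/ffunP => i.
by rewrite !ffunE !za !ffunE /= /bump; congr (a _, psi a _); lia.
Qed.

Hypothesis down : forall a b i, X a -> X b ->
  (forall j, i <= j -> j <= i + T%:Z -> a j = b j) -> psi a i = psi b i.
Hypothesis right : forall a b i, X a -> X b ->
  (forall j, i <= j -> j < i + T%:Z -> a j = b j) ->
  (forall j, i <= j -> j <= i + T%:Z -> psi a j = psi b j) ->
  a (i + T%:Z) = b (i + T%:Z).

(** The arcs of the textile system are the strips of width [T.+1] of a point
    above its image, and the vertices such strips without their last or first
    column.  A strip is its terminal vertex with a first column added: the
    upper entry of it is read off by [p] and the lower one is then forced by
    [down].  It is also its initial vertex with a last column added, the lower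
    entry of which is read off by [q] and the upper one forced by [right]. *)
Lemma strip_textile (B : finType) (p q : {ffun 'I_T.+1 -> A * A} -> B)
    (Y : set (config B)) (chi : config B -> config B) :
  (forall w w', p w = p w' -> (w ord0).1 = (w' ord0).1) ->
  (forall w w', q w = q w' -> (w ord_max).2 = (w' ord_max).2) ->
  Y = (fun a j => p (strip psi T.+1 a j)) @` X ->
  (forall a, X a -> chi (fun j => p (strip psi T.+1 a j)) =
     (fun j => q (strip psi T.+1 a j))) ->
  (forall a, X a -> Y (fun j => q (strip psi T.+1 a j))) ->
  weakly_LR Y chi.
Proof.
move=> pinj qinj defY chiE Yq.
pose ph := @hom_bouquet strip_graph B (fun e : arc => p (val e)).
pose qh := @hom_bouquet strip_graph B (fun e : arc => q (val e)).
exists (Textile ph qh); first split.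
- move=> [w pw] [w' pw'] /= /ffunP tab /pinj pab.
  case/asboolP: (pw) => a Xa wa; case/asboolP: (pw') => b Xb wb.
  apply/val_inj => /=; rewrite wa wb in tab pab *.
  have ab0 : a 0 = b 0 by move: pab; rewrite !ffunE /= addr0.
  have tl (i : 'I_T) : a (i.+1%:Z) = b i.+1%:Z /\ psi a (i.+1%:Z) = psi b i.+1%:Z.
    by have := tab i; rewrite !ffunE /= /bump /= !add0r add1n => -[].
  have aE (j : int) : 0 <= j -> j <= 0 + T%:Z -> a j = b j.
    case: j => // -[|j] _ jT //.
    have jT' : (j < T)%N by lia.
    by case: (tl (Ordinal jT')).
  apply/ffunP => -[i iT]; rewrite !ffunE /= add0r; congr pair; first by apply: aE; lia.
  case: i iT => [|i] iT; first exact: down.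
  by case: (tl (Ordinal (iT : (i < T)%N))).
- move=> [w pw] [w' pw'] /= /ffunP tab /qinj qab.
  case/asboolP: (pw) => a Xa wa; case/asboolP: (pw') => b Xb wb.
  apply/val_inj => /=; rewrite wa wb in tab qab *.
  have abT : psi a T%:Z = psi b T%:Z by move: qab; rewrite !ffunE /= add0r.
  have tl (i : 'I_T) : a (i%:Z) = b i%:Z /\ psi a (i%:Z) = psi b i%:Z.
    by have := tab i; rewrite !ffunE /= !add0r => -[].
  have aE (j : int) : 0 <= j -> j < 0 + T%:Z -> a j = b j.
    by case: j => // j _ jT; have jT' : (j < T)%N by []; case: (tl (Ordinal jT')).
  have pE (j : int) : 0 <= j -> j <= 0 + T%:Z -> psi a j = psi b j.
    case: j => // j _ jT; have [->//|jT'] := eqVneq j T.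
    have jT2 : (j < T)%N by lia.
    by case: (tl (Ordinal jT2)).
  apply/ffunP => -[i iT]; rewrite !ffunE /= add0r; congr pair; last by apply: pE; lia.
  have [->|iT'] := eqVneq i T; last by apply: aE; lia.
  by have := right Xa Xb aE pE; rewrite add0r.
have im (f : {ffun 'I_T.+1 -> A * A} -> B) z a :
    (forall j, val (z j : arc) = strip psi T.+1 a j) ->
    letter_map (fun e : arc => f (val e)) z = (fun j => f (strip psi T.+1 a j)).
  by move=> za; apply/funext => j; rewrite /letter_map za.
have pK a b : (fun j => p (strip psi T.+1 a j)) = (fun j => p (strip psi T.+1 b j)) ->
    a = b.
  move=> ab; apply/funext => j.
  by have /pinj := congr1 (fun c => c j) ab; rewrite !ffunE /= addr0.
exists strip_path, (fun b : B => b); split; split.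
- exact: strip_path_closed.
- exact: strip_path_shift.
- exact: strip_path_paths.
- by move=> b b' _ _.
- move=> z z'; rewrite !inE => -[a Xa za] [b Xb zb] /=.
  rewrite (im p z a) // (im p z' b) // => /pK ab.
  by apply/funext => j; apply/val_inj; rewrite za zb ab.
- rewrite defY predeqE => y; split.
    move=> [z [a Xa za] <-]; exists (fun j => p (strip psi T.+1 a j)).
      by exists a.
    by rewrite letter_map_id /= (im p z a).
  move=> [_ [a Xa <-] <-]; exists (fun j => strip_arc j Xa); first by exists a.
  by rewrite letter_map_id /= (im p _ a).
- move=> _ [z [a Xa za] <-]; exists (fun j => q (strip psi T.+1 a j)); first exact: Yq.
  by rewrite letter_map_id /= (im q z a).
- move=> z y [a Xa za]; rewrite defY => -[b Xb <-] /=.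
  rewrite !letter_map_id (im p z a) // (im q z a) // => /pK ->.
  by rewrite chiE.
Qed.

End Strips.

Lemma strip_top (A : choiceType) psi T (a : config A) j (i : 'I_T) :
  (strip psi T a j i).1 = a (j + i%:Z).
Proof. by rewrite ffunE. Qed.

Lemma strip_bottom (A : choiceType) psi T (a : config A) j (i : 'I_T) :
  (strip psi T a j i).2 = psi a (j + i%:Z).
Proof. by rewrite ffunE. Qed.

Lemma higher_map_block (A : choiceType) u (phi : config A -> config A) a :
  higher_map u.+1 phi (block u.+1 a) = block u.+1 (phi a).
Proof.
rewrite /higher_map; congr (block _ (phi _)); apply/funext => j.
by rewrite /block /thead tnth_mktuple addr0.
Qed.

Section Causal.
Variables (A : finType) (X : set (config A)) (psi : config A -> config A).
Hypothesis cell : cellular_map X psi.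

(** In a strip of width [T.+1] the last [u] lower letters lie [T.+1 - u] columns
    to the right of the first [u] upper ones; this distance is the power of the
    shift.  With [u = 1] the blocks are single letters and [X] itself is
    presented. *)
Lemma LR_of_windows (T : nat) :
  (forall a b i, X a -> X b ->
    (forall j, i <= j -> j <= i + T%:Z -> a j = b j) -> psi a i = psi b i) ->
  (forall a b i, X a -> X b ->
    (forall j, i <= j -> j < i + T%:Z -> a j = b j) ->
    (forall j, i <= j -> j <= i + T%:Z -> psi a j = psi b j) ->
    a (i + T%:Z) = b (i + T%:Z)) ->
  (forall u, (1 <= u)%N -> (u <= T.+1)%N ->
    higher_LR u X (psi \o sigma_pow (T.+1 - u)%N%:Z)) /\
  weakly_LR X (psi \o sigma_pow T%:Z).
Proof.
move=> down right.
have psis s a : X a -> psi (sigma_pow s a) = sigma_pow s (psi a).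
  exact: (cell_comm cell).
have Xpsi s a : X a -> X (psi (sigma_pow s a)).
  by move=> Xa; apply/(cell_stable cell)/(cell_shift cell).
split=> [[//|u] _ uT|].
- pose p (w : {ffun 'I_T.+1 -> A * A}) := [tuple (w (inord i)).1 | i < u.+1].
  pose q (w : {ffun 'I_T.+1 -> A * A}) :=
    [tuple (w (inord (T.+1 - u.+1 + i)%N)).2 | i < u.+1].
  have pE a j : p (strip psi T.+1 a j) = word a j u.+1.
    apply: eq_from_tnth => i; rewrite !tnth_mktuple strip_top inordK //.
    exact: leq_trans (ltn_ord i) uT.
  have qE a j : X a -> q (strip psi T.+1 a j) =
      word (psi (sigma_pow (T.+1 - u.+1)%N%:Z a)) j u.+1.
    move=> Xa; apply: eq_from_tnth => i; rewrite !tnth_mktuple strip_bottom.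
    rewrite inordK; last by have := ltn_ord i; lia.
    by rewrite psis // /sigma_pow; congr (psi a); lia.
  apply: (strip_textile cell down right (p := p) (q := q)).
  + move=> w w' /(congr1 (fun t => tnth t ord0)); rewrite !tnth_mktuple.
    by rewrite (_ : inord _ = ord0) //; apply/val_inj; rewrite /= inordK.
  + move=> w w' /(congr1 (fun t => tnth t ord_max)); rewrite !tnth_mktuple.
    rewrite (_ : inord _ = ord_max) //; apply/val_inj.
    by rewrite /= inordK; lia.
  + rewrite /higher_block; congr (_ @` _); apply/funext => a; apply/funext => j.
    by rewrite pE.
  + move=> a Xa; rewrite (_ : (fun j => p _) = block u.+1 a); last first.
      by apply/funext => j; rewrite pE.
    by rewrite higher_map_block; apply/funext => j; rewrite qE.
  + move=> a Xa; exists (psi (sigma_pow (T.+1 - u.+1)%N%:Z a)); first exact: Xpsi.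
    by apply/funext => j; rewrite qE.
- pose p (w : {ffun 'I_T.+1 -> A * A}) := (w ord0).1.
  pose q (w : {ffun 'I_T.+1 -> A * A}) := (w ord_max).2.
  have pE a : (fun j => p (strip psi T.+1 a j)) = a.
    by apply/funext => j; rewrite /p strip_top addr0.
  have qE a : X a -> (fun j => q (strip psi T.+1 a j)) = psi (sigma_pow T%:Z a).
    by move=> Xa; apply/funext => j; rewrite /q strip_bottom psis.
  apply: (strip_textile cell down right (p := p) (q := q)) => //.
  + by rewrite predeqE => a; split=> [Xa|[b Xb <-]]; [exists a|rewrite pE].
  + by move=> a Xa; rewrite pE qE.
  + by move=> a Xa; rewrite qE //; apply: Xpsi.
Qed.

Lemma LR_of_causal_closing : left_causal X psi 0 -> right_closing X psi 0 ->
  exists2 t : nat, (1 <= t)%N & forall T, (t <= T.+1)%N ->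
    (forall u, (1 <= u)%N -> (u <= T.+1)%N ->
      higher_LR u X (psi \o sigma_pow (T.+1 - u)%N%:Z)) /\
    weakly_LR X (psi \o sigma_pow T%:Z).
Proof.
move=> lc rc.
have [n1 h1] := left_causal_window cell lc.
have [n2 h2] := right_closing_window cell rc.
(* The window of causality has [n1.+1] columns, out of [T.+1]; that of closing
   has [n2.+1], out of the [T] columns before the one to be determined. *)
exists (maxn n1 n2).+2 => // T nT; apply: LR_of_windows.
- move=> a b i Xa Xb ab; have := h1 a b i Xa Xb; rewrite subr0; apply => j j1 j2.
  by apply: ab; lia.
- move=> a b i Xa Xb ab pab; have := h2 a b (i + T%:Z - 1) Xa Xb.
  rewrite subrK; apply.
    by move=> j j1 j2; apply: ab; lia.
  by move=> j j1 j2; apply: pab; lia.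
Qed.

End Causal.

Lemma comp_sigmaD (A : choiceType) (phi : config A -> config A) s t :
  (phi \o sigma_pow s) \o sigma_pow t = phi \o sigma_pow (s + t).
Proof. by apply/funext => a /=; rewrite sigma_powD. Qed.

(** The width of the strips depends on [X] alone, so the shift that they bring
    about is compensated in the map to which they are applied. *)
Lemma LR_of_finite (A : finType) (X : set (config A)) phi s :
  cellular_map X phi -> finite_set X -> weakly_LR X (phi \o sigma_pow s).
Proof.
move=> cell fX.
have [n hn] := finite_window (cell_closed cell) (cell_shift cell) fX.
have := @LR_of_windows _ _ _ (cellular_shift (s - n.+1%:Z) cell) n.+1.
rewrite comp_sigmaD subrK => -[||//] a b i Xa Xb ab.
  by rewrite (hn a b i) // => j j1 j2; apply: ab; lia.
by rewrite (hn a b i) // => j j1 j2; apply: ab; lia.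
Qed.

Lemma left_causal_shift (A : finType) (X : set (config A)) phi r s :
  cellular_map X phi ->
  left_causal X (phi \o sigma_pow s) r <-> left_causal X phi (r - s).
Proof.
move=> cell; split=> h a b Xa Xb ab; have := h a b Xa Xb ab;
  by rewrite /= !(cell_comm cell) // /sigma_pow (_ : - r + s = - (r - s)) //; lia.
Qed.

Lemma right_closing_shift (A : finType) (X : set (config A)) phi r s :
  cellular_map X phi ->
  right_closing X (phi \o sigma_pow s) r <-> right_closing X phi (r - s).
Proof.
move=> cell; split=> h a b Xa Xb ab pab; apply: h => // j j1.
  by rewrite /= !(cell_comm cell) // /sigma_pow; apply: pab; lia.
have := pab (j - s); rewrite /= !(cell_comm cell) // /sigma_pow subrK; apply.
lia.
Qed.

(** * Causality and closing from textile systems *)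

(** Since [phi_p] is injective on the compact [Z], the arc of a path at 0 is
    fixed by finitely many letters of its [p]-image; so two paths with the same
    upper row on a half-line agree far out on it, and the resolving properties
    carry the agreement back to the end, arc by arc. *)
Lemma weakly_LR_causal_closing (B : choiceType) (Y : set (config B)) chi :
  (forall a, Y a -> Y (chi a)) -> weakly_LR Y chi ->
  left_causal Y chi 0 /\ right_closing Y chi 0.
Proof.
move=> stY [T [pres qres] [Z [iota]]] /= [[cZ sZ Zpath] [iinj pinj pZ qZ qchi]].
have shZ s z := @shift_invariant _ Z s z sZ.
have iotaE a b j k : Y a -> Y b -> iota (a j) = iota (b k) -> a j = b k.
  move=> Ya Yb; apply: iinj; rewrite inE.
    by exists a => //; exists j.
  by exists b => //; exists k.
have [|||n hn] := @finitely_determined (arc_of (upper T)) _ _ Z setT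
    (fun j z => p_hom T (z j)) (fun z => z 0) cZ.
- by move=> j _; apply: locally_constant_coord.
- exact: (@locally_constant_coord _ _ Z id).
- move=> z w Zz Zw zw; congr (_ 0); apply: pinj; rewrite ?inE //.
  by apply/funext => j; apply: zw.
have det z w i : Z z -> Z w ->
    (forall j, i - n%:Z <= j -> j <= i + n%:Z -> p_hom T (z j) = p_hom T (w j)) ->
    z i = w i.
  move=> Zz Zw zw; have := hn _ _ (shZ i z Zz) (shZ i w Zw).
  rewrite /sigma_pow add0r; apply => j _ j1 j2; apply: zw; lia.
have lift a : Y a -> exists2 z, Z z & (forall j, p_hom T (z j) = iota (a j)) /\
    (forall j, q_hom T (z j) = iota (chi a j)).
  move=> Ya; have : (letter_map iota @` Y) (letter_map iota a) by exists a.
  rewrite -pZ => -[z Zz za]; exists z => //.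
  have zq := qchi z a Zz Ya za.
  by split => j; [exact: (congr1 (fun c => c j) za)|exact: (congr1 (fun c => c j) zq)].
split=> a b Ya Yb ab.
- have [z Zz [zp zq]] := lift a Ya; have [w Zw [wp wq]] := lift b Yb.
  have far j : n%:Z <= j -> z j = w j.
    by move=> nj; apply: det => // l l1 _; rewrite zp wp ab //; lia.
  have back (k : nat) : forall j, 0 <= j -> n%:Z <= j + k%:Z -> z j = w j.
    elim: k => [|k IH] j j0 jk; first by apply: far; lia.
    apply: pres; last by rewrite zp wp ab.
    rewrite (Zpath z Zz) (Zpath w Zw); congr ini; apply: IH; lia.
  apply: iotaE; [exact: stY|exact: stY|].
  by rewrite -zq -wq (back n) //; lia.
- move=> cab.
  have [z Zz [zp zq]] := lift a Ya; have [w Zw [wp wq]] := lift b Yb.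
  have far j : j <= - n%:Z -> z j = w j.
    by move=> nj; apply: det => // l _ l1; rewrite zp wp ab //; lia.
  have back (k : nat) : forall j, j <= 1 -> j - k%:Z <= - n%:Z -> z j = w j.
    elim: k => [|k IH] j j0 jk; first by apply: far; lia.
    apply: qres; last by rewrite zq wq cab //; lia.
    rewrite -(subrK 1 j) -(Zpath z Zz) -(Zpath w Zw); congr ter; apply: IH; lia.
  apply: iotaE => //; rewrite -zp -wp (back n.+1) //; lia.
Qed.

Lemma higher_LR_causal_closing (A : finType) (X : set (config A)) phi t :
  cellular_map X phi -> (1 <= t)%N -> higher_LR t X phi ->
  left_causal X phi 0 /\ right_closing X phi 0.
Proof.
move=> cell; case: t => // t _.
move=> /weakly_LR_causal_closing[|lc rc].
  move=> _ [a Xa <-]; rewrite higher_map_block; exists (phi a) => //.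
  exact: (cell_stable cell).
have Yb a : X a -> higher_block t.+1 X (block t.+1 a) by exists a.
split=> a b Xa Xb ab.
- have := lc _ _ (Yb a Xa) (Yb b Xb); rewrite !higher_map_block.
  have -> : (- 0 = 0 :> int) by [].
  move=> /(_ _)/(congr1 (fun w => tnth w ord0)); rewrite /block !tnth_mktuple.
  apply => j j0; apply: eq_from_tnth => i; rewrite !tnth_mktuple.
  by apply: ab; lia.
(* Shifted back by [t] columns, the blocks up to 0 end at the coordinate 0 of
   the point, and the last letter of the next one is the coordinate 1. *)
- move=> pab.
  have Xs c : X c -> X (sigma_pow (- t%:Z) c) by exact: (cell_shift cell).
  have := rc _ _ (Yb _ (Xs a Xa)) (Yb _ (Xs b Xb)).
  rewrite !higher_map_block !(cell_comm cell) //.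
  move=> /(_ _ _)/(congr1 (fun w => tnth w ord_max)).
  rewrite /block !tnth_mktuple /sigma_pow /= (addrK t%:Z).
  apply => j j0; apply: eq_from_tnth => i; rewrite !tnth_mktuple /sigma_pow;
    [apply: ab|apply: pab]; have := ltn_ord i; lia.
Qed.

(** * Reflection of textile systems *)

Definition rev_graph (G : digraph) : digraph := Graph (@ter G) (@ini G).

Definition rev_hom (H G : digraph) (h : graph_hom H G) :
    graph_hom (rev_graph H) (rev_graph G) :=
  @GraphHom (rev_graph H) (rev_graph G) (hom_arc h) (@hom_vertex _ _ h)
    (hom_ter h) (hom_ini h).

Definition rev_textile (T : textile) : textile :=
  Textile (rev_hom (p_hom T)) (rev_hom (q_hom T)).

Lemma letter_map_mirror (A B : choiceType) (h : A -> B) (a : config A) :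
  letter_map h (mirror a) = mirror (letter_map h a).
Proof. by []. Qed.

Lemma letters_mirror (A : choiceType) (X : set (config A)) :
  letters (mirror_set X) = letters X.
Proof.
rewrite predeqE => c; split=> -[a Xa [j <-]].
  by exists (mirror a) => //; exists (- j); rewrite /mirror opprK.
exists (mirror a); rewrite /mirror_set /= ?mirrorK //.
by exists (- j); rewrite /mirror opprK.
Qed.

Lemma image_mirror (A B : choiceType) (f : config A -> config B)
    (X : set (config A)) :
  (forall a, f (mirror a) = mirror (f a)) ->
  f @` mirror_set X = mirror_set (f @` X).
Proof.
move=> fm; rewrite predeqE => b; split=> [[a Xa <-]|[a Xa ab]].
  by rewrite /mirror_set /= -fm; exists (mirror a).
exists (mirror a); first by rewrite /mirror_set /= mirrorK.
by rewrite fm ab mirrorK.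
Qed.

Lemma realized_by_mirror (A : choiceType) (X : set (config A)) phi T :
  realized_by X phi T ->
  realized_by (mirror_set X) (mirror_map phi) (rev_textile T).
Proof.
move=> [Z [iota [[cZ sZ Zpath] [iinj pinj pZ qZ qchi]]]].
exists (mirror_set Z), iota; split; split.
- exact: closed_mirror.
- have sh s z := @shift_invariant _ Z s z sZ.
  rewrite predeqE => z; split=> [[y Zy <-]|Zz].
    by rewrite /mirror_set /= mirror_sigma; apply: sh.
  exists (sigma_pow (-1) z); last by rewrite sigma_powD addrN sigma_pow0.
  by rewrite /mirror_set /= mirror_sigma; apply: sh.
- move=> z /Zpath zp j; have := zp (- j - 1); rewrite /mirror subrK => zE.
  by rewrite /= -[in RHS](opprK (j + 1)) opprD zE opprK.
- by rewrite letters_mirror.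
- move=> z w; rewrite !inE => Zz Zw zw.
  rewrite -(mirrorK z) -(mirrorK w); congr mirror.
  apply: pinj; rewrite ?inE // !letter_map_mirror; congr mirror.
  exact: zw.
- rewrite !image_mirror //; congr mirror_set; exact: pZ.
- rewrite !image_mirror // => z Zz; exact: qZ Zz.
- move=> z a Zz Xa za.
  have za' : letter_map (p_hom T) (mirror z) = letter_map iota (mirror a).
    by rewrite !letter_map_mirror; congr mirror.
  have := qchi _ _ Zz Xa za'; rewrite !letter_map_mirror /mirror_map => <-.
  by rewrite mirrorK.
Qed.

(** Reversing the arcs exchanges left- and right-resolving. *)
Lemma weakly_RL_mirror (A : choiceType) (X : set (config A)) phi :
  weakly_RL X phi <-> weakly_LR (mirror_set X) (mirror_map phi).
Proof.
split=> [[T [pr ql] rT]|[T [pl qr] /realized_by_mirror]].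
  by exists (rev_textile T); [split|exact: realized_by_mirror].
rewrite mirror_setK mirror_mapK => rT.
by exists (rev_textile T) => //; split.
Qed.

(** A textile system realizes a map up to an injective renaming of letters,
    since the letters are only identified with arcs through [iota]. *)
Lemma realized_by_recode (A B : choiceType) (g : A -> B) (h : B -> A)
    (X : set (config A)) phi (Y : set (config B)) chi T :
  cancel g h -> Y = letter_map g @` X ->
  (forall a, X a -> chi (letter_map g a) = letter_map g (phi a)) ->
  realized_by X phi T -> realized_by Y chi T.
Proof.
move=> gK -> chiE [Z [iota [hZ [iinj pinj pZ qZ qchi]]]].
have iE a : letter_map (iota \o h) (letter_map g a) = letter_map iota a.
  by apply/funext => j; rewrite /letter_map /= gK.
have imE : letter_map (iota \o h) @` (letter_map g @` X) = letter_map iota @` X.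
  rewrite predeqE => c; split=> [[_ [a Xa <-] <-]|[a Xa <-]].
    by exists a; rewrite // iE.
  by exists (letter_map g a); rewrite ?iE //; exists a.
exists Z, (iota \o h); split => //; split=> //.
- move=> b b'; rewrite !inE => -[_ [a Xa <-] [j <-]] [_ [a' Xa' <-] [j' <-]].
  rewrite /letter_map /= !gK => aa; congr g; apply: iinj => //; rewrite inE.
    by exists a => //; exists j.
  by exists a' => //; exists j'.
- by rewrite imE.
- by rewrite imE.
- by move=> z _ Zz [a Xa <-]; rewrite iE chiE // iE; apply: qchi.
Qed.

Definition rev_word (A : choiceType) (t : nat) (w : t.-tuple A) : t.-tuple A :=
  [tuple tnth w (rev_ord i) | i < t].

Lemma rev_wordK (A : choiceType) t : involutive (@rev_word A t).
Proof. by move=> w; apply: eq_from_tnth => i; rewrite !tnth_mktuple rev_ordK. Qed.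

Lemma rev_word_block (A : choiceType) t (a : config A) :
  letter_map (@rev_word A t.+1) (mirror (block t.+1 a)) =
  block t.+1 (mirror (sigma_pow t%:Z a)).
Proof.
apply/funext => j; apply: eq_from_tnth => i.
rewrite !tnth_mktuple /mirror /sigma_pow /=; congr a.
by have := ltn_ord i; lia.
Qed.

(** The blocks of a mirror image are the reversed blocks, so the two higher
    block presentations differ by a recoding. *)
Lemma higher_mirror (A : finType) (X : set (config A)) phi t T :
  cellular_map X phi ->
  realized_by (mirror_set (higher_block t.+1 X))
    (mirror_map (higher_map t.+1 phi)) T ->
  realized_by (higher_block t.+1 (mirror_set X))
    (higher_map t.+1 (mirror_map phi)) T.
Proof.
move=> cell; apply: realized_by_recode (@rev_wordK A t.+1) _ _.
- rewrite predeqE => y; split=> [[a Xa <-]|[z [a Xa az] <-]].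
    exists (mirror (block t.+1 (sigma_pow (- t%:Z) (mirror a)))).
      rewrite /mirror_set /= mirrorK; eexists; last by [].
      exact: (cell_shift cell).
    by rewrite rev_word_block sigma_powD addrN sigma_pow0 mirrorK.
  rewrite -(mirrorK z) -az rev_word_block.
  exists (mirror (sigma_pow t%:Z a)) => //.
  by rewrite /mirror_set /= mirrorK; apply: (cell_shift cell).
- move=> z [a Xa az]; rewrite -(mirrorK z) -az rev_word_block higher_map_block.
  rewrite {2}/mirror_map mirrorK higher_map_block rev_word_block.
  by rewrite /mirror_map mirrorK (cell_comm cell).
Qed.

Lemma higher_RL_mirror (A : finType) (X : set (config A)) phi t :
  cellular_map X phi -> (1 <= t)%N ->
  higher_RL t X phi <-> higher_LR t (mirror_set X) (mirror_map phi).
Proof.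
move=> cell; case: t => // t _; split.
  move=> /weakly_RL_mirror[T rT /(higher_mirror cell)]; by exists T.
rewrite -{2}(mirror_setK X) -{2}(mirror_mapK phi) => -[T [pl qr] /realized_by_mirror].
move=> /(higher_mirror (cellular_mirror cell)) rT.
by exists (rev_textile T).
Qed.

(** * Expansiveness *)

Definition window_expansive (A : choiceType) (X : set (config A))
    (phi : config A -> config A) : Prop :=
  exists K, forall x y, full_orbit X phi x -> full_orbit X phi y ->
    (forall i, window_eq K (x i) (y i)) -> x = y.

(** A full orbit is a two-dimensional array.  With one unit to spare in both
    inequalities, a wide strip of columns determines the next column on
    either side. *)
Lemma causal_closing_expansive (A : finType) (X : set (config A)) psi :
  cellular_map X psi -> left_causal X psi 1 -> right_closing X psi 1 ->
  window_expansive X psi.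
Proof.
move=> cell lc rc.
have [n1 h1] := left_causal_window cell lc.
have [n2 h2] := right_closing_window cell rc.
exists (maxn n1 n2) => x y ox oy; set K := maxn n1 n2 => xyK.
have xy (k : nat) i : window_eq (K + k) (x i) (y i).
  elim: k i => [|k IH] i; first by rewrite addn0.
  move=> j j1 j2; have [|jk] := boolP ((- (K + k)%N%:Z <= j) && (j <= (K + k)%N%:Z)).
    by case/andP; apply: IH.
  (* The coordinate [j] lies just to the left or just to the right of the
     band.  On the left it is read in the image of the previous point. *)
  have [jneg|jpos] := leP j 0.
    have := h1 (x (i - 1)) (y (i - 1)) (j + 1) (ox _).1 (oy _).1.
    rewrite (ox _).2 (oy _).2.
    have -> : j + 1 - 1 = j by lia.
    have <- : i = i - 1 + 1 by lia.
    apply => l l1 l2.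
    by apply: IH; lia.
  have := h2 (x i) (y i) (j - 1) (ox _).1 (oy _).1; rewrite subrK; apply.
    by move=> l l1 l2; apply: IH; lia.
  by rewrite (ox _).2 (oy _).2 => l l1 l2; apply: IH; lia.
apply/funext => i; apply/funext => j.
by apply: (xy `|j|%N i); lia.
Qed.

Lemma window_expansive_mirror (A : choiceType) (X : set (config A)) phi :
  window_expansive (mirror_set X) (mirror_map phi) -> window_expansive X phi.
Proof.
move=> [K hK]; exists K => x y ox oy xy.
have om z : full_orbit X phi z ->
    full_orbit (mirror_set X) (mirror_map phi) (fun i => mirror (z i)).
  by move=> oz i; rewrite /mirror_set /mirror_map /= !mirrorK (oz i).2; split=> //;
    exact: (oz i).1.
have /(congr1 (fun z i => mirror (z i))) := hK _ _ (om x ox) (om y oy)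
  (fun i => mirror_window (xy i)).
by under eq_fun do rewrite mirrorK; under [in RHS]eq_fun do rewrite mirrorK.
Qed.

Lemma window_expansive_metric (A : finType) (X : set (config A)) phi
    (R : realType) (d : config A -> config A -> R) :
  closed X -> compatible_metric X d -> window_expansive X phi ->
  expansive X d phi.
Proof.
move=> cX cd [K hK]; have [delta d0 hd] := metric_window K cX cd.
exists delta => // x y ox oy xy; apply: hK => // i.
by apply: hd => //; [case: (ox i)|case: (oy i)].
Qed.

(** * The two families of weakly LR and weakly RL maps *)

Section Families.
Variables (A : finType) (X : set (config A)) (phi : config A -> config A).
Hypothesis cell : cellular_map X phi.

Lemma higher_LR_iff :
  (exists2 t : nat, (1 <= t)%N & higher_LR t X phi) <->
  left_causal X phi 0 /\ right_closing X phi 0.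
Proof.
split=> [[t t1]|[lc rc]]; first exact: higher_LR_causal_closing.
have [[//|t] _ ht] := LR_of_causal_closing cell lc rc.
exists t.+1 => //; have [/(_ t.+1 isT (leqnn _)) + _] := ht t (leqnn _).
suff -> : phi \o sigma_pow (t.+1 - t.+1)%N%:Z = phi by [].
by apply/funext => a; rewrite subnn /= sigma_pow0.
Qed.

Lemma higher_LR_shift_bound s :
  (exists2 t : nat, (1 <= t)%N & higher_LR t X (phi \o sigma_pow s)) ->
  left_causal X phi (- s) /\ right_closing X phi (- s).
Proof.
move=> [t t1 /(higher_LR_causal_closing (cellular_shift s cell) t1)].
by rewrite left_causal_shift // right_closing_shift // sub0r.
Qed.

Lemma LR_family c : left_causal X phi (- c) -> right_closing X phi (- c) ->
  exists2 t : nat, (1 <= t)%N &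
    (forall (s : int) (u : nat), (1 <= u)%N -> (u <= t)%N -> s = c + (t%:Z - u%:Z) ->
       higher_LR u X (phi \o sigma_pow s)) /\
    (forall s : int, c + t%:Z <= s -> weakly_LR X (phi \o sigma_pow s)).
Proof.
move=> lc rc.
have [|| [//|t] _ ht] := LR_of_causal_closing (cellular_shift c cell).
- by rewrite left_causal_shift // sub0r.
- by rewrite right_closing_shift // sub0r.
exists t.+1 => //; split=> [s u u1 ut ->|s cs].
  have [/(_ u u1 ut) + _] := ht t (leqnn _).
  by rewrite comp_sigmaD subzn.
have [|_] := ht `|s - c|%N; first by lia.
by rewrite comp_sigmaD (_ : c + _ = s) //; lia.
Qed.

Lemma LR_expansive s : left_causal X phi (1 - s) -> right_closing X phi (1 - s) ->
  window_expansive X (phi \o sigma_pow s).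
Proof.
move=> lc rc; apply: causal_closing_expansive; first exact: cellular_shift.
  by rewrite left_causal_shift.
by rewrite right_closing_shift.
Qed.

End Families.

Section MirrorFamilies.
Variables (A : finType) (X : set (config A)) (phi : config A -> config A).
Hypothesis cell : cellular_map X phi.

Let mcell := cellular_mirror cell.

Lemma higher_RL_shift_mirror s t : (1 <= t)%N ->
  higher_RL t X (phi \o sigma_pow s) <->
  higher_LR t (mirror_set X) (mirror_map phi \o sigma_pow (- s)).
Proof.
by move=> t1; rewrite higher_RL_mirror ?mirror_map_sigma //; exact: cellular_shift.
Qed.

Lemma higher_RL_iff :
  (exists2 t : nat, (1 <= t)%N & higher_RL t X phi) <->
  left_causal (mirror_set X) (mirror_map phi) 0 /\
  right_closing (mirror_set X) (mirror_map phi) 0.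
Proof.
rewrite -(higher_LR_iff mcell).
by split=> -[t t1] h; exists t => //; apply/(higher_RL_mirror cell t1).
Qed.

Lemma higher_RL_shift_bound s :
  (exists2 t : nat, (1 <= t)%N & higher_RL t X (phi \o sigma_pow s)) ->
  left_causal (mirror_set X) (mirror_map phi) s /\
  right_closing (mirror_set X) (mirror_map phi) s.
Proof.
move=> [t t1 /(higher_RL_shift_mirror _ t1) h].
rewrite -(opprK s); apply: (higher_LR_shift_bound mcell).
by exists t.
Qed.

Lemma RL_family c : left_causal (mirror_set X) (mirror_map phi) c ->
  right_closing (mirror_set X) (mirror_map phi) c ->
  exists2 t : nat, (1 <= t)%N &
    (forall (s : int) (u : nat), (1 <= u)%N -> (u <= t)%N -> s = c - (t%:Z - u%:Z) ->
       higher_RL u X (phi \o sigma_pow s)) /\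
    (forall s : int, s <= c - t%:Z -> weakly_RL X (phi \o sigma_pow s)).
Proof.
move=> lc rc; have [||t t1 [ht wt]] := LR_family mcell (c := - c).
- by rewrite opprK.
- by rewrite opprK.
exists t => //; split=> [s u u1 ut sE|s cs].
  by apply/higher_RL_shift_mirror => //; apply: ht => //; lia.
by apply/weakly_RL_mirror; rewrite mirror_map_sigma; apply: wt; lia.
Qed.

Lemma RL_of_finite s : finite_set X -> weakly_RL X (phi \o sigma_pow s).
Proof.
move=> fX; apply/weakly_RL_mirror; rewrite mirror_map_sigma.
by apply: LR_of_finite => //; apply/finite_mirror.
Qed.

Lemma RL_expansive s : left_causal (mirror_set X) (mirror_map phi) (s + 1) ->
  right_closing (mirror_set X) (mirror_map phi) (s + 1) ->
  window_expansive X (phi \o sigma_pow s).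
Proof.
move=> lc rc; apply: window_expansive_mirror; rewrite mirror_map_sigma.
by apply: (LR_expansive mcell); rewrite opprK addrC.
Qed.

End MirrorFamilies.

(** In an infinite subshift [Q_R <= n] for a map of type [(m, n)], so an
    infinite bound forces the subshift to be finite. *)
Lemma right_closing_all_finite (A : finType) (X : set (config A)) phi (x0 : A) :
  cellular_map X phi -> (forall r, right_closing X phi r) -> finite_set X.
Proof.
move=> cell rc; apply: contrapT => iX; have [m [n [f tf]]] := has_type_ex x0 cell.
by apply: (right_closing_bounded cell tf iX _ (rc (n%:Z + 1))); lia.
Qed.

Theorem theorem7p8 (A : finType) (hA : (1 < #|A|)%N)
    (X : set (config A)) (hX : subshift X)
    (R : realType) (dX : config A -> config A -> R)
    (hdX : compatible_metric X dX)
    (phi : config A -> config A) (hphi : endomorphism X phi) :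
  (* (1)(a) *)
  ((exists2 t : nat, (1 <= t)%N & higher_LR t X phi) <->
     (0 <= P_L X phi)%E /\ (0 <= Q_R X phi)%E) /\
  (* (1)(b) *)
  (forall s : int,
     (exists2 t : nat, (1 <= t)%N & higher_LR t X (phi \o sigma_pow s)) ->
     (C_R X phi <= s%:E)%E) /\
  (exists2 t : nat, (1 <= t)%N &
     (forall s : int,
        (C_R X phi <= s%:E)%E -> (s%:E <= C_R X phi + t%:Z%:E - 1%:E)%E ->
        exists2 u : nat, (u%:Z%:E = t%:Z%:E - s%:E + C_R X phi)%E &
          (1 <= u)%N /\ higher_LR u X (phi \o sigma_pow s)) /\
     (forall s : int, (C_R X phi + t%:Z%:E <= s%:E)%E ->
        weakly_LR X (phi \o sigma_pow s))) /\
  (* (1)(c) *)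
  (forall s : int, (C_R X phi < s%:E)%E -> phi @` X = X ->
     expansive X dX (phi \o sigma_pow s)) /\
  (* (2)(a) *)
  ((exists2 t : nat, (1 <= t)%N & higher_RL t X phi) <->
     (0 <= P_R X phi)%E /\ (0 <= Q_L X phi)%E) /\
  (* (2)(b) *)
  (forall s : int,
     (exists2 t : nat, (1 <= t)%N & higher_RL t X (phi \o sigma_pow s)) ->
     (s%:E <= C_L X phi)%E) /\
  (exists2 t : nat, (1 <= t)%N &
     (forall s : int,
        (C_L X phi - t%:Z%:E + 1%:E <= s%:E)%E -> (s%:E <= C_L X phi)%E ->
        exists2 u : nat, (u%:Z%:E = t%:Z%:E + s%:E - C_L X phi)%E &
          (1 <= u)%N /\ higher_RL u X (phi \o sigma_pow s)) /\
     (forall s : int, (s%:E <= C_L X phi - t%:Z%:E)%E ->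
        weakly_RL X (phi \o sigma_pow s))) /\
  (* (2)(c) *)
  (forall s : int, (s%:E < C_L X phi)%E -> phi @` X = X ->
     expansive X dX (phi \o sigma_pow s)).
Proof.
have cell := endomorphism_cellular hX hphi.
have [x0 _] : exists x : A, x \in A by apply/card_gt0P; exact: ltnW.
have mcell := cellular_mirror cell.
split; first by rewrite (higher_LR_iff cell) -(P_L_geP x0 cell) -(Q_R_geP x0 cell).
split; first by move=> s /(higher_LR_shift_bound cell) /(C_R_leP x0 cell).
split.
  have := C_R_leP x0 cell; case: (C_R X phi) => [c| |] CP.
  - have [lc rc] := (CP c).1 (lexx _).
    have [t t1 [ht wt]] := LR_family cell lc rc.
    exists t => //; split=> [s|s]; rewrite -!EFinD !lee_fin.
      move=> cs st; exists `|(t%:Z - s + c)%R|%N; first by congr EFin; lia.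
      by split; [lia|apply: ht; lia].
    exact: wt.
  - by exists 1%N => //; split=> s; rewrite ?addye // leye_eq.
  - have fX : finite_set X.
      apply: (right_closing_all_finite x0 cell) => r.
      by rewrite -(opprK r); case: ((CP (- r)).1 (leNye _)).
    exists 1%N => //; split=> s; first by rewrite !addNye leeNy_eq.
    by move=> _; exact: LR_of_finite.
split.
  move=> s sC _; apply: window_expansive_metric hdX _; first exact: (cell_closed cell).
  have /(C_R_leP x0 cell) [lc rc] : (C_R X phi <= (s - 1)%:E)%E.
    case: (C_R X phi) sC => [c| |] //; rewrite ?lte_fin ?lee_fin ?leNye //; lia.
  by apply: (LR_expansive cell); rewrite -opprB.
split; first by rewrite (higher_RL_iff cell) -(P_R_geP x0 cell) -(Q_L_geP x0 cell).
split; first by move=> s /(higher_RL_shift_bound cell) /(C_L_geP x0 cell).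
split.
  have := C_L_geP x0 cell; case: (C_L X phi) => [c| |] CP.
  - have [lc rc] := (CP c).1 (lexx _).
    have [t t1 [ht wt]] := RL_family cell lc rc.
    exists t => //; split=> [s|s]; rewrite -?EFinN -!EFinD !lee_fin.
      move=> cs st; exists `|(t%:Z + s - c)%R|%N; first by congr EFin; lia.
      by split; [lia|apply: ht; lia].
    exact: wt.
  - have fX : finite_set X.
      apply/finite_mirror; apply: (right_closing_all_finite x0 mcell) => r.
      by case: ((CP r).1 (leey _)).
    exists 1%N => //; split=> s; first by rewrite !addye // leye_eq.
    by move=> _; exact: RL_of_finite.
  - exists 1%N => //; split=> s; rewrite ?addNye leeNy_eq //.
move=> s sC _; apply: window_expansive_metric hdX _; first exact: (cell_closed cell).
have /(C_L_geP x0 cell) [lc rc] : ((s + 1)%:E <= C_L X phi)%E.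
  case: (C_L X phi) sC => [c| |] //; rewrite ?lte_fin ?lee_fin ?leey //; lia.
exact: (RL_expansive cell).
Qed.
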